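(* Let $n\ge1$ and $\zeta>0$. Consider the generalized eigenvalue problem $\vec A_n^1\vec y=\hat\lambda\,\vec A_n^0\vec y$, $\vec y\ne0$. Besides a zero eigenvalue, denoted by $\hat\lambda_{0,n}$, the matrix pair $\vec A_n^0$, $\vec A_n^1$ has $2n$ non-zero, real and simple generalized eigenvalues, which satisfy $$\hat\lambda_{i,n}=\frac{\sqrt{z_{i,n}^2-1}}{z_{i,n}},\qquad |\hat\lambda_{i,n}|<1,\qquad i=\pm1,\dots,\pm n,$$ and $$\frac{\partial\hat\lambda_{i,n}}{\partial\zeta}<0,\ i=1,\dots,n;\qquad \frac{\partial\hat\lambda_{i,n}}{\partial\zeta}>0,\ i=-n,\dots,-1.$$ The corresponding $2n+1$ generalized eigenvectors can be expressed as $\vec y_{i,n}=(\vec u_{i,n}^T,\vec v_{i,n}^T)^T$ with $$\vec u_{i,n}=\vec P_n^{(0)}(z_{i,n};\zeta)P_n^{(1)}(-z_{i,n};\zeta)+\vec P_n^{(0)}(-z_{i,n};\zeta)P_n^{(1)}(z_{i,n};\zeta),$$ $$\vec v_{i,n}=\sqrt{z_{i,n}^2-1}\left(\vec P_{n-1}^{(1)}(z_{i,n};\zeta)P_n^{(1)}(-z_{i,n};\zeta)-\vec P_{n-1}^{(1)}(-z_{i,n};\zeta)P_n^{(1)}(z_{i,n};\zeta)\right)$$ for $i=\pm1,\dots,\pm n$, and $$\vec u_{0,n}=\vec P_n^{(0)}(1;\zeta)P_{n+1}^{(0)}(-1;\zeta)-\vec P_n^{(0)}(-1;\zeta)P_{n+1}^{(0)}(1;\zeta),\qquad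 \vec v_{0,n}=0.$$
   Context: For $\zeta>0$ let $K_1(\zeta)=\int_0^\infty\cosh(\vartheta)e^{-\zeta\cosh\vartheta}d\vartheta$. For $\ell\in\{0,1\}$ let $\omega^{(\ell)}(x;\zeta)=K_1(\zeta)^{-1}(x^2-1)^{\ell-1/2}e^{-\zeta x}$ on $[1,\infty)$ and $(f,g)_{\omega^{(\ell)}}=\int_1^\infty f(x)g(x)\omega^{(\ell)}(x;\zeta)dx$. $\{P_n^{(\ell)}(x;\zeta)\}_{n\ge0}$ are the orthonormal polynomials in $x$ for $(\cdot,\cdot)_{\omega^{(\ell)}}$, $\deg P_n^{(\ell)}=n$, with leading coefficient $c_n^{(\ell)}>0$ and simple zeros $1<x_{1,n}^{(\ell)}<\dots<x_{n,n}^{(\ell)}$. Put $\vec P_n^{(\ell)}=(P_0^{(\ell)},\dots,P_n^{(\ell)})^T$, $a_n^{(\ell)}=c_n^{(\ell)}/c_{n+1}^{(\ell)}$, $b_n^{(\ell)}=(xP_n^{(\ell)},P_n^{(\ell)})_{\omega^{(\ell)}}$, $p_n=c_n^{(0)}/c_n^{(1)}$, $q_n=\frac{c_n^{(1)}}{c_{n+1}^{(0)}}\big(\sum_{i=1}^{n+2}x_{i,n+2}^{(0)}-\sum_{i=1}^nx_{i,n}^{(1)}\big)$, $r_n=c_{n-1}^{(1)}/c_{n+1}^{(0)}$ ($n\ge1$). $\vec J_n^{(\ell)}$ is the $(n+1)\times(n+1)$ symmetric tridiagonal matrix with diagonal $b_0^{(\ell)},\dots,b_n^{(\ell)}$ and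 off-diagonal $a_0^{(\ell)},\dots,a_{n-1}^{(\ell)}$. $\vec J_n$ is the $(n+1)\times(n+2)$ matrix with entries (rows $k=0,\dots,n$, columns $j=0,\dots,n+1$) $p_k$ at $(k,k)$, $q_k$ at $(k,k+1)$, $r_{k+1}$ at $(k,k+2)$ when $k+2\le n+1$, and $0$ elsewhere. The $(2n+1)\times(2n+1)$ matrices are $$\vec A_n^0=\begin{pmatrix}\vec J_n^{(0)}&0\\0&\vec J_{n-1}^{(1)}\end{pmatrix},\qquad \vec A_n^1=\begin{pmatrix}0&\vec J_{n-1}^T\\ \vec J_{n-1}&0\end{pmatrix}.$$ $Q_{2n}(x;\zeta)=P_{n+1}^{(0)}(x;\zeta)P_n^{(1)}(-x;\zeta)+P_{n+1}^{(0)}(-x;\zeta)P_n^{(1)}(x;\zeta)$ is an even polynomial of degree $2n$ in $x$ with $2n$ real simple zeros $z_{i,n}=z_{i,n}(\zeta)$, $i=\pm1,\dots,\pm n$, where $z_{-i,n}=-z_{i,n}$ and $1<z_{1,n}<\dots<z_{n,n}$. *)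

(* Defs.v *)
From HB Require Import structures.
From mathcomp Require Import all_boot all_order all_algebra.
From mathcomp Require Import complex polyrcf.
From mathcomp Require Import all_classical all_reals all_analysis.

Set Implicit Arguments.
Unset Strict Implicit.
Unset Printing Implicit Defensive.

Import Order.TTheory GRing.Theory Num.Theory numFieldNormedType.Exports.

Local Open Scope ring_scope.
Local Open Scope classical_set_scope.

Section GeneralizedEigenvalues.
Context {F : fieldType} {m : nat}.
Implicit Types (A B : 'M[F]_m) (mu : F).

(* The problem is A y = mu B y. *)
Definition gen_eigenvalue A B mu : Prop :=
  exists2 y : 'cV[F]_m, y != 0 & A *m y = mu *: (B *m y).

Definition char_pencil A B : {poly F} :=
  \det (map_mx polyC A - 'X *: map_mx polyC B).

(* Algebraic simplicity. *)
Definition simple_gen_eigenvalue A B mu : Prop :=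
  gen_eigenvalue A B mu /\ mup mu (char_pencil A B) = 1%N.

End GeneralizedEigenvalues.

Definition complex_mx (R : rcfType) (m n : nat) (A : 'M[R]_(m, n)) :
  'M[R[i]]_(m, n) := map_mx (fun x : R => (x%:C)%C) A.

Section Weights.
Context {R : realType}.
Implicit Types (x t zeta : R) (l : nat) (f g : R -> R).

Definition cosh t : R := (expR t + expR (- t)) / 2.

Definition K1 zeta : R :=
  Rintegral lebesgue_measure `[0, +oo[
    (fun t => cosh t * expR (- zeta * cosh t)).

Definition omega l zeta x : R :=
  (K1 zeta)^-1 * ((x ^+ 2 - 1) `^ (l%:R - 2^-1)) * expR (- zeta * x).

Definition ip l zeta f g : R :=
  Rintegral lebesgue_measure `[1, +oo[ (fun x => f x * g x * omega l zeta x).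

(* With the positive leading coefficients this determines P uniquely. *)
Definition orthonormal_polys l zeta (P : nat -> {poly R}) : Prop :=
  (forall n, size (P n) = n.+1 /\ 0 < lead_coef (P n)) /\
  (forall i j, ip l zeta (horner (P i)) (horner (P j)) = (i == j)%:R).

End Weights.

(* P l n stands for P_n^(l)(. ; zeta), with l = 0 or 1. *)
Section Coefficients.
Context {R : realType} (zeta : R) (P : nat -> nat -> {poly R}).
Implicit Types (l n m k : nat) (x : R) (i : int).

Definition lc l n : R := lead_coef (P l n).

Definition acoef l n : R := lc l n / lc l n.+1.
Definition bcoef l n : R :=
  ip l zeta (horner ('X * P l n)) (horner (P l n)).

(* rootsR lists the distinct real roots in increasing order; those of P l n are
   n in number, all simple. *)
Definition sum_zeros l n : R := \sum_(x <- rootsR (P l n)) x.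

Definition pcoef n : R := lc 0 n / lc 1 n.
Definition qcoef n : R :=
  lc 1 n / lc 0 n.+1 * (sum_zeros 0 n.+2 - sum_zeros 1 n).
(* Only used for n >= 1. *)
Definition rcoef n : R := lc 1 n.-1 / lc 0 n.+1.

(* Matrices are indexed by their number of rows: J_n^(l) is [jacobi l n.+1] and
   J_n is [jrect n.+1]; thus J_{n-1}^(l) and J_{n-1} are the ones at n. *)
Definition jacobi l m : 'M[R]_m :=
  \matrix_(i < m, j < m)
    if (j == i :> nat)%N then bcoef l i
    else if (j == i.+1 :> nat)%N then acoef l i
    else if (i == j.+1 :> nat)%N then acoef l j
    else 0.

Definition jrect m : 'M[R]_(m, m.+1) :=
  \matrix_(k < m, j < m.+1)
    if (j == k :> nat)%N then pcoef k
    else if (j == k.+1 :> nat)%N then qcoef k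
    else if (j == k.+2 :> nat)%N then rcoef k.+1
    else 0.

Definition A0 n : 'M[R]_(n.+1 + n) :=
  block_mx (jacobi 0 n.+1) 0 0 (jacobi 1 n).

Definition A1 n : 'M[R]_(n.+1 + n) :=
  block_mx 0 (jrect n)^T (jrect n) 0.

Definition Qpoly n : {poly R} :=
  P 0 n.+1 * (P 1 n \Po - 'X) + (P 0 n.+1 \Po - 'X) * P 1 n.

(* z_{i,n} for i = +-1, ..., +-n: the zeros of Q_{2n} greater than 1 are
   z_{1,n} < ... < z_{n,n}, and z_{-i,n} = - z_{i,n}.  The value at i = 0 has
   no meaning. *)
Definition zQ n i : R :=
  (sgz i)%:~R * nth 0 [seq x <- rootsR (Qpoly n) | 1 < x] `|i|%N.-1.

(* (P_0^(l)(x), ..., P_{m-1}^(l)(x))^T *)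
Definition Pvec l m x : 'cV[R]_m := \col_(k < m) (P l k).[x].

Definition uvec n i : 'cV[R]_n.+1 :=
  if i == 0 then
    (P 0 n.+1).[-1] *: Pvec 0 n.+1 1 - (P 0 n.+1).[1] *: Pvec 0 n.+1 (-1)
  else let z := zQ n i in
    (P 1 n).[- z] *: Pvec 0 n.+1 z + (P 1 n).[z] *: Pvec 0 n.+1 (- z).

Definition vvec n i : 'cV[R]_n :=
  if i == 0 then 0
  else let z := zQ n i in
    Num.sqrt (z ^+ 2 - 1) *:
      ((P 1 n).[- z] *: Pvec 1 n z - (P 1 n).[z] *: Pvec 1 n (- z)).

Definition yvec n i : 'cV[R]_(n.+1 + n) := col_mx (uvec n i) (vvec n i).

End Coefficients.

(* Main.v *)
Require Import Defs.
From HB Require Import structures.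
From mathcomp Require Import all_boot all_order all_algebra.
From mathcomp Require Import complex polyrcf.
From mathcomp Require Import all_classical all_reals all_analysis.
From mathcomp Require Import measurable_realfun lebesgue_integral_under.
From mathcomp Require Import ring lra zify.
Import Order.TTheory GRing.Theory Num.Theory numFieldNormedType.Exports.
Local Open Scope ring_scope.

Set Implicit Arguments.
Unset Strict Implicit.
Unset Printing Implicit Defensive.

(** The moment functional [L p = K1^-1 * \int p(x) (x^2-1)^(-1/2) e^(-zeta x)]
is positive, the polynomials [P 0] are orthonormal for [L], and the [P 1] for
[(x^2-1) L].  Read a vector [(u, v)] as the two polynomials
[f = \sum u_k P_k^(0)] and [g = \sum v_k P_k^(1)].  The connection coefficients
[p_k], [q_k], [r_k] are the numbers [L ((x^2-1) P_k^(1) P_j^(0))], so the pencil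
is made of Gram matrices: [A1] is the form
[L ((x^2-1) (g phi + f psi))] and [A0] the form
[L (x (f phi + (x^2-1) g psi))], which is positive definite since [x > 0] on the
support.  An eigenvector for [lam] is thus a pair with
[(x^2-1) g - lam x f] orthogonal to degree at most [n], and [f - lam x g]
orthogonal, for [(x^2-1) L], to degree less than [n] ([eigen_pair]).
Combinations of reproducing kernels at [z] and [-z] satisfy these relations up
to one boundary term, a multiple of [Q(z)], so the zeros of [Q] give eigenvectors
with [lam = sqrt (z^2-1) / z] ([eigen_pair_kernel]).

The polynomial [Q] has exactly [n] zeros beyond 1: the zeros of [P_{n+1}^(0)] and
[P_n^(1)] interlace ([interlace]), whence [Q] changes sign between consecutive
zeros of [P_{n+1}^(0)] ([size_zeros_gt1]).  With the opposite zeros and [lam = 0]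
this makes [2n+1] distinct eigenvalues.  Their eigenvectors are orthogonal for
[A0], hence form a basis ([gram_unit]), and a pencil with a basis of
eigenvectors for distinct eigenvalues has no other eigenvalue, even complex, and
only simple ones ([spectral_facts]).

For the monotonicity, compare the weak eigenvalue relation at [t] and at [zeta],
each tested against the eigenvector at the other parameter.  The difference
expresses [lam t - lam zeta] through differences of moments, and in the limit
[lam' = - L (x ((x^2-1) 2 f g - lam x (f^2 + (x^2-1) g^2))) / L (x (f^2 + (x^2-1) g^2))]
([lamQ_quotient]).  The sign of the numerator is an inequality of Markov type
([eigen_pair_markov]).  Writing [(x^2-1) g - lam x f = al P_{n+1}^(0)] and
[f - lam x g = be P_n^(1)], it reduces to the positivity of
[lam (al^2 + be^2) + al be (c/c' + c'/c)], where [c < c'] are the leading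
coefficients of [P_n^(1)] and [P_{n+1}^(0)].  Evaluation at [-z], where neither
polynomial vanishes, gives [al / be], and with [s = sqrt (z^2-1)] the inequality
follows from [c |P_{n+1}^(0)(-z)| > c' (1+z) |P_n^(1)(-z)|] because
[lam = 2 tau / (1 + tau^2)] for [tau = s / (1+z)].  That last bound holds since
[c P_{n+1}^(0) - c' (x-1) P_n^(1)] is, up to a negative factor, the orthogonal
polynomial of degree [n] for the weight [x+1] ([ortho_ratio_bound]).

The analysis starts from the normalisation of [P_0^(0)].  A divergent integral of a
nonnegative function has real value 0, so [(P_0, P_0) = 1] shows that the
weight is integrable and that [K1 > 0].  Laplace integrals can then be
differentiated under the integral sign ([laplace_moment_derive]),
Gram-Schmidt makes the coefficients of all the polynomials continuous in [zeta]
([orthonormal_cvg]), and sign changes around each zero of [Q] make the zeros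
continuous ([nth_zeros_cvg]).  Continuity of the eigenvectors is all that the
difference argument needs. *)

(** * Top coefficients of polynomials *)

Section CoefLemmas.
Context {R : idomainType}.
Implicit Types p q : {poly R}.

Lemma size_le_coef0 p n : (size p <= n.+1)%N -> p`_n = 0 -> (size p <= n)%N.
Proof.
move=> sp pn; apply/leq_sizeP => j; rewrite leq_eqVlt => /predU1P[<-//|nj].
by move/leq_sizeP: sp; apply.
Qed.

Lemma coefM_top p q m n : (size p <= m.+1)%N -> (size q <= n.+1)%N ->
  (p * q)`_(m + n) = p`_m * q`_n.
Proof.
move=> sp sq; rewrite coefM.
rewrite (bigD1 (Ordinal (leq_addr n m : m < (m + n).+1)%N)) //= addKn big1 ?addr0 //.
move=> i; rewrite -val_eqE /= neq_ltn => /orP[im|mi].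
  by rewrite [q`_ _]nth_default ?mulr0 // (leq_trans sq) //; lia.
by rewrite nth_default ?mul0r // (leq_trans sp).
Qed.

Lemma size_mul_le p q m n : (size p <= m.+1)%N -> (size q <= n.+1)%N ->
  (size (p * q)%R <= (m + n).+1)%N.
Proof.
move=> sp sq; apply: leq_trans (size_polyMleq _ _) _.
by move: sp sq; move: (size p) (size q) => a b; lia.
Qed.

End CoefLemmas.

Lemma coef_compN (R : comNzRingType) (p : {poly R}) k :
  (p \Po - 'X)`_k = (-1) ^+ k * p`_k.
Proof.
elim/poly_ind: p k => [|p c IH] k; first by rewrite comp_poly0 !coef0 mulr0.
rewrite comp_polyD comp_polyM comp_polyX comp_polyC mulrN coefD coefN !coefD.
rewrite !coefMX !coefC; case: k => [|k] /=; first by rewrite oppr0 !add0r mul1r.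
by rewrite !addr0 IH exprS mulN1r mulNr.
Qed.

(** * Positive functionals and orthogonal polynomials *)

Section PositiveFunctional.
Context {R : rcfType}.
Implicit Types (p q r d W : {poly R}) (x c z : R).

Definition pos_functional (L : {poly R} -> R) : Prop :=
  [/\ forall p q, L (p + q) = L p + L q,
      forall c p, L (c *: p) = c * L p
    & forall p, p != 0 -> (forall x, 1 < x -> 0 <= p.[x]) -> 0 < L p].

Definition ortho_lower (L : {poly R} -> R) W n p : Prop :=
  forall q, (size q <= n)%N -> L (W * p * q) = 0.

Definition pos_weight W : Prop := forall x, 1 < x -> 0 < W.[x].

Variable L : {poly R} -> R.
Hypothesis posL : pos_functional L.

Lemma functionalD p q : L (p + q) = L p + L q.
Proof. by case: posL. Qed.

Lemma functionalZ c p : L (c *: p) = c * L p.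
Proof. by case: posL. Qed.

Lemma functional_gt0 p : p != 0 -> (forall x, 1 < x -> 0 <= p.[x]) -> 0 < L p.
Proof. by case: posL => _ _; apply. Qed.

Lemma functional0 : L 0 = 0.
Proof. by rewrite -(scale0r 0) functionalZ mul0r. Qed.

Lemma functionalN p : L (- p) = - L p.
Proof. by rewrite -scaleN1r functionalZ mulN1r. Qed.

Lemma functionalB p q : L (p - q) = L p - L q.
Proof. by rewrite functionalD functionalN. Qed.

Lemma functional_sum (I : Type) (s : seq I) (P : pred I) (F : I -> {poly R}) :
  L (\sum_(i <- s | P i) F i) = \sum_(i <- s | P i) L (F i).
Proof. exact: (big_morph L functionalD functional0). Qed.

Lemma functional_ge0 p : (forall x, 1 < x -> 0 <= p.[x]) -> 0 <= L p.
Proof.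
have [->|p0 pp] := eqVneq p 0; first by rewrite functional0.
by rewrite ltW // functional_gt0.
Qed.

Lemma pos_weight_neq0 W : pos_weight W -> W != 0.
Proof.
by move=> Wp; apply: contraTneq (Wp 2 (ltr1n _ 2)) => ->; rewrite horner0 ltxx.
Qed.

Lemma functional_sqr_gt0 W q : pos_weight W -> q != 0 -> 0 < L (W * q * q).
Proof.
move=> Wp q0; apply: functional_gt0 => [|x x1].
  by rewrite !mulf_neq0 // pos_weight_neq0.
by rewrite -mulrA hornerM hornerM -expr2 mulr_ge0 ?sqr_ge0 // ltW // Wp.
Qed.

Section OrthogonalPolynomial.
Variables (W p : {poly R}) (n : nat).
Hypotheses (Wp : pos_weight W) (sp : size p = n.+1).
Hypothesis op : ortho_lower L W n p.

Let p0 : p != 0.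
Proof. by rewrite -size_poly_eq0 sp. Qed.

(** With [p = d q], orthogonality to [q] would read [L (W d q^2) = 0].  All the
information on the zeros of orthogonal polynomials comes from this remark,
applied to linear, squared and rootless factors. *)
Lemma ortho_no_nonneg_divisor d q : p = d * q -> (1 < size d)%N ->
  ~ (forall x, 1 < x -> 0 <= d.[x]).
Proof.
move=> pE sd dp.
have /andP[d0 q0] : (d != 0) && (q != 0) by move: p0; rewrite pE mulf_eq0 negb_or.
have sq : (size q <= n)%N.
  move: sp; rewrite pE size_mul //.
  by move: sd; case: (size d) => [|[|k]] //= _ [<-]; rewrite leq_addl.
have := op sq; apply/eqP; rewrite gt_eqF // functional_gt0 //.
  by rewrite !mulf_neq0 // pos_weight_neq0.
move=> x x1; rewrite pE -!mulrA !hornerM -expr2.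
by apply: mulr_ge0; [rewrite ltW // Wp | apply: mulr_ge0; rewrite ?sqr_ge0 ?dp].
Qed.

Lemma ortho_root_gt1 c : root p c -> 1 < c.
Proof.
move=> /factor_theorem[q pE]; rewrite ltNge; apply/negP => c1.
rewrite mulrC in pE; apply: (ortho_no_nonneg_divisor pE).
  by rewrite size_XsubC.
by move=> x x1; rewrite hornerXsubC subr_ge0 (le_trans c1) // ltW.
Qed.

Lemma in_rootsR r c : r != 0 -> (c \in rootsR r) = root r c.
Proof. by move=> r0; rewrite -roots_on_rootsR. Qed.

Lemma poly_norootP q : (forall x, ~~ root q x) -> forall x y, 0 < q.[x] * q.[y].
Proof.
move=> nr x y; wlog xy : x y / x <= y.
  by move=> H; case: (lerP x y) => [|/ltW] /H //; rewrite mulrC.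
rewrite ltNge; apply/negP => /(polyrcf.poly_ivt xy)[c _]; exact/negP.
Qed.

(** A zero of the cofactor of the distinct real zeros would be a double zero of
[p], and a nonconstant cofactor without real zeros would have constant sign. *)
Lemma ortho_factor : p = lead_coef p *: \prod_(x <- rootsR p) ('X - x%:P).
Proof.
have ra : all (root p) (rootsR p) by apply/allP => x; rewrite in_rootsR.
have ru : poly.uniq_roots (rootsR p) by rewrite uniq_rootsE uniq_roots.
have [q pE] := uniq_roots_prod_XsubC ra ru.
have q0 : q != 0 by apply: contraNneq p0 => q0; rewrite pE q0 mul0r.
have nrq x : ~~ root q x.
  apply/negP => rqx.
  have xr : x \in rootsR p by rewrite in_rootsR // pE rootM rqx.
  have /factor_theorem[q1 q1E] : root (\prod_(y <- rootsR p) ('X - y%:P)) x.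
    by rewrite root_prod_XsubC.
  have /factor_theorem[q2 q2E] := rqx.
  (* a zero of the cofactor is a double zero of p *)
  have : p = (('X - x%:P) * ('X - x%:P)) * (q2 * q1) by rewrite pE q1E {1}q2E; ring.
  move/ortho_no_nonneg_divisor; apply.
    by rewrite size_mul ?polyXsubC_eq0 // size_XsubC.
  by move=> y _; rewrite hornerM -expr2 sqr_ge0.
have sq : (size q <= 1)%N.
  rewrite leqNgt; apply/negP => sq.
  have q00 : q.[0] != 0 by rewrite -rootE.
  (* the factor q.[0] makes the rootless divisor nonnegative *)
  have : p = (q.[0] *: q) * (q.[0]^-1 *: \prod_(y <- rootsR p) ('X - y%:P)).
    by rewrite -scalerAl -scalerAr scalerA divff // scale1r -pE.
  move/ortho_no_nonneg_divisor; apply; first by rewrite size_scale.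
  by move=> x _; rewrite hornerZ ltW // poly_norootP.
have -> : lead_coef p = q`_0.
  rewrite pE lead_coefM (monicP (monic_prod_XsubC _ _ _)) mulr1.
  by rewrite (size1_polyC sq) lead_coefC coefC.
by rewrite {1}pE {1}(size1_polyC sq) mul_polyC.
Qed.

Lemma ortho_size_rootsR : size (rootsR p) = n.
Proof.
have := sp; rewrite {1}ortho_factor size_scale ?lead_coef_eq0 //.
by rewrite size_prod_XsubC => -[].
Qed.

Lemma ortho_sign c : c <= 1 -> 0 < (-1) ^+ n * lead_coef p * p.[c].
Proof.
move=> c1; rewrite {2}ortho_factor hornerZ horner_prod.
under eq_bigr => x _ do rewrite hornerXsubC -opprB -mulN1r.
rewrite big_split /= big_const_seq count_predT ortho_size_rootsR.
rewrite -Monoid.iteropE /= -[iterop _ _ _ _]/((-1) ^+ n) .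
have -> (a b u : R) : a * b * (b * (a * u)) = (a * a) * (b * b) * u by ring.
rewrite -!expr2 sqrr_sign mul1r mulr_gt0 ?exprn_even_gt0 ?lead_coef_eq0 //.
rewrite big_seq prodr_gt0 // => x xr.
rewrite subr_gt0 (le_lt_trans c1) // ortho_root_gt1 //.
by rewrite -in_rootsR.
Qed.

Lemma ortho_horner_neq0 c : c <= 1 -> p.[c] != 0.
Proof. by move=> /ortho_sign H; apply: contraTneq H => ->; rewrite mulr0 ltxx. Qed.

Lemma ortho_sum_roots :
  \sum_(x <- rootsR p) x = - (if n is m.+1 then p`_m else 0) / lead_coef p.
Proof.
have := ortho_size_rootsR; case E : n => [|m].
  by move=> /size0nil ->; rewrite big_nil oppr0 mul0r.
move=> sr; have := @coefPn_prod_XsubC _ (rootsR p); rewrite sr => /(_ isT) H.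
have -> : p`_m = - (lead_coef p * \sum_(x <- rootsR p) x).
  by rewrite {1}ortho_factor coefZ H mulrN.
by rewrite opprK mulrAC divff ?mul1r // lead_coef_eq0.
Qed.

End OrthogonalPolynomial.
End PositiveFunctional.

(** * An orthonormal pair for the weights 1 and X^2 - 1 *)

Section OrthonormalPair.
Context {R : rcfType}.
Implicit Types (p q r d W f g phi psi : {poly R}) (x c z y a b : R).

(** Only the properties of a single member of an orthonormal family, so that the
extremal arguments can be run on one polynomial for each of two weights. *)
Definition orthonormal_at (L : {poly R} -> R) W n p : Prop :=
  [/\ size p = n.+1, 0 < lead_coef p, ortho_lower L W n p & L (W * p * p) = 1].

(** The polynomial [Q_{2n}] when [p = P_{n+1}^(0)] and [q = P_n^(1)]. *)
Definition Qpair p q : {poly R} := p * (q \Po - 'X) + (p \Po - 'X) * q.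

Lemma horner_compN p x : (p \Po - 'X).[x] = p.[- x].
Proof. by rewrite horner_comp hornerN hornerX. Qed.

Lemma Qpair_horner p q x : (Qpair p q).[x] = p.[x] * q.[- x] + p.[- x] * q.[x].
Proof. by rewrite /Qpair hornerD !hornerM !horner_compN. Qed.

Lemma pos_weight1 : pos_weight (1 : {poly R}).
Proof. by move=> x _; rewrite hornerC ltr01. Qed.

Lemma pos_weight_Xp1 : pos_weight ('X + 1 : {poly R}).
Proof. by move=> x x1; rewrite !hornerE; lra. Qed.

Lemma pos_weight_X2 : pos_weight ('X^2 - 1 : {poly R}).
Proof. by move=> x x1; rewrite !hornerE subr_gt0 exprn_egt1. Qed.

Variable L : {poly R} -> R.
Hypothesis posL : pos_functional L.

Let LD := functionalD posL.
Let LZ := functionalZ posL.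
Let LB := functionalB posL.

Lemma orthonormal_coef W n p q : orthonormal_at L W n p ->
  (size q <= n.+1)%N -> L (W * p * q) = q`_n / lead_coef p.
Proof.
move=> [sp lp op np] sq; set k := _ / _.
have lp0 : lead_coef p != 0 by rewrite gt_eqF.
have -> : W * p * q = k *: (W * p * p) + W * p * (q - k *: p).
  by rewrite -!mul_polyC; ring.
rewrite LD LZ np mulr1 op ?addr0 //; apply: size_le_coef0.
  rewrite (leq_trans (size_polyD _ _)) // geq_max sq size_polyN.
  by rewrite (leq_trans (size_scale_leq _ _)) // sp.
have pn : p`_n = lead_coef p by rewrite /lead_coef sp.
by rewrite coefB coefZ pn /k divfK // subrr.
Qed.

Variables (n : nat) (p0 p1 : {poly R}).
Hypotheses (on0 : orthonormal_at L 1 n.+1 p0)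
  (on1 : orthonormal_at L ('X^2 - 1) n p1).

Let c0 := lead_coef p0.
Let c1 := lead_coef p1.
Let s0 : size p0 = n.+2. Proof. by case: on0. Qed.
Let s1 : size p1 = n.+1. Proof. by case: on1. Qed.
Let c0_gt0 : 0 < c0. Proof. by case: on0. Qed.
Let c1_gt0 : 0 < c1. Proof. by case: on1. Qed.
Let o0 : ortho_lower L 1 n.+1 p0. Proof. by case: on0. Qed.
Let o1 : ortho_lower L ('X^2 - 1) n p1. Proof. by case: on1. Qed.
Let c0E : p0`_n.+1 = c0. Proof. by rewrite /c0 /lead_coef s0. Qed.
Let c1E : p1`_n = c1. Proof. by rewrite /c1 /lead_coef s1. Qed.
Let p0_neq0 : p0 != 0. Proof. by rewrite -size_poly_eq0 s0. Qed.
Let p1_neq0 : p1 != 0. Proof. by rewrite -size_poly_eq0 s1. Qed.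

Let Lp0 q : (size q <= n.+2)%N -> L (p0 * q) = q`_n.+1 / c0.
Proof. by move=> sq; rewrite -(orthonormal_coef on0 sq) mul1r. Qed.

Let Lp1 q : (size q <= n.+1)%N -> L (('X^2 - 1) * p1 * q) = q`_n / c1.
Proof. by move=> sq; rewrite -(orthonormal_coef on1 sq). Qed.

(** [p0] has the smallest norm for its leading coefficient, and the
competitor [(X - 1) p1] has norm less than 1 because
[(x-1)^2 < (x-1)(x+1)] on the support. *)
Lemma lead_coef_lt : c1 < c0.
Proof.
have sX : size ('X - 1 : {poly R}) = 2 by rewrite size_XsubC.
have sq : (size (('X - 1) * p1)%R <= n.+2)%N.
  by rewrite -[n.+2]/(1 + n).+1 size_mul_le ?sX ?s1.
have qn : (('X - 1) * p1)`_n.+1 = c1.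
  rewrite -[n.+1]/(1 + n)%N coefM_top ?sX ?s1 // coefB coefX coef1 subr0 mul1r.
  exact: c1E.
(* Bessel's inequality along p0 *)
have bessel : (c1 / c0) ^+ 2 <= L (('X - 1) * p1 * (('X - 1) * p1)).
  set q := ('X - 1) * p1; set k := c1 / c0.
  have : 0 <= L ((q - k *: p0) * (q - k *: p0)).
    apply: functional_ge0 => // x _.
    by rewrite hornerM -expr2 sqr_ge0.
  have -> : (q - k *: p0) * (q - k *: p0) =
      q * q - (2 * k) *: (p0 * q) + (k ^+ 2) *: (p0 * p0).
    by rewrite -!mul_polyC; ring.
  rewrite LD LB !LZ !Lp0 ?s0 // qn c0E divff ?gt_eqF // -/k; lra.
have lt : L (('X - 1) * p1 * (('X - 1) * p1)) < 1.
  have [_ _ _ <-] := on1; rewrite -subr_gt0 -LB.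
  have -> : ('X^2 - 1) * p1 * p1 - ('X - 1) * p1 * (('X - 1) * p1) =
      (2 *: ('X - 1)) * p1 * p1 by rewrite -mul_polyC; ring.
  apply: functional_sqr_gt0 => // x x1; rewrite !hornerE; lra.
have := le_lt_trans bessel lt.
rewrite expr_lt1 // ?divr_ge0 ?(ltW c0_gt0) ?(ltW c1_gt0) //.
by rewrite ltr_pdivrMr // mul1r.
Qed.

(** Strict interlacing in the form [p1(y) p0'(y) > 0], since [d(y) = p0'(y)].
Dividing [q] by [X - y] gives [L (d q) = q(y) L d + L (p0 q')] for a quotient [q'].
For [q = d] the last term vanishes, so [d(y) L d = L (d^2)].  For
[q = (X^2-1) p1] it is [c1/c0], while the left-hand side is [c0/c1]; hence
[(y^2-1) p1(y) L d = c0/c1 - c1/c0], which is positive by [lead_coef_lt]. *)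
Lemma interlace y d : p0 = d * ('X - y%:P) -> 0 < p1.[y] * d.[y].
Proof.
move=> pE.
have d0 : d != 0 by apply: contraNneq p0_neq0 => d0; rewrite pE d0 mul0r.
have sd : size d = n.+1.
  by have := s0; rewrite pE size_mul ?polyXsubC_eq0 // size_XsubC addn2 => -[].
have dn : d`_n = c0.
  by rewrite /c0 pE lead_coefM lead_coefXsubC mulr1 /lead_coef sd.
have y1 : 1 < y.
  apply: (ortho_root_gt1 posL pos_weight1 s0 o0).
  by rewrite pE rootM root_XsubC eqxx orbT.
have taylor q k : (size q <= k.+2)%N ->
    exists q', [/\ q = ('X - y%:P) * q' + q.[y]%:P, (size q' <= k.+1)%N & q'`_k = q`_k.+1].
  move=> sq.
  have /factor_theorem[q' q'E] : root (q - q.[y]%:P) y.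
    by rewrite rootE !hornerE subrr.
  have qE : q = ('X - y%:P) * q' + q.[y]%:P by rewrite mulrC -q'E subrK.
  have sq' : (size q' <= k.+1)%N.
    have [->|q'0] := eqVneq q' 0; first by rewrite size_poly0.
    have : size (q - q.[y]%:P) = (size q').+1.
      by rewrite q'E size_mul ?polyXsubC_eq0 // size_XsubC addn2.
    move=> e; rewrite -ltnS -e (leq_trans (size_polyD _ _)) // geq_max sq.
    by rewrite size_polyN (leq_trans (size_polyC_leq1 _)).
  exists q'; split=> //.
  rewrite qE coefD coefC addr0 -[k.+1]/(1 + k)%N coefM_top ?size_XsubC //.
  by rewrite coefB coefX coefC subr0 mul1r.
have Ld : 0 < d.[y] * L d.
  suff -> : d.[y] * L d = L (1 * d * d).
    exact: (functional_sqr_gt0 posL pos_weight1).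
  case E : (n) => [|m].
    move: sd; rewrite E => /eqP/size_poly1P[c _ ->].
    by rewrite mul1r hornerC mul_polyC LZ.
  have [|q [dE sq _]] := taylor d m; first by rewrite sd E.
  have -> : L (1 * d * d) = L (d * (('X - y%:P) * q + d.[y]%:P)).
    by rewrite -dE mul1r.
  rewrite mulrDr LD mulrA -pE Lp0.
    rewrite nth_default ?mul0r ?add0r ?(leq_trans sq) ?E //.
    by rewrite (mulrC d) mul_polyC LZ.
  by rewrite (leq_trans sq) // E; lia.
have sX2 : size ('X^2 - 1 : {poly R}) = 3%N by rewrite size_XnsubC.
have [|q [WE sq qn]] := taylor (('X^2 - 1) * p1) n.+1.
  by rewrite -[n.+3]/(2 + n).+1 size_mul_le ?sX2 ?s1.
have Wp1 : c0 / c1 = c1 / c0 + (y ^+ 2 - 1) * p1.[y] * L d.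
  have -> : c0 / c1 = L (('X^2 - 1) * p1 * d) by rewrite Lp1 ?sd // dn.
  rewrite [in LHS]WE mulrC mulrDr LD mulrA -pE.
  rewrite Lp0 // qn -[n.+2]/(2 + n)%N coefM_top ?sX2 ?s1 // c1E.
  by rewrite coefB coefXn coef1 subr0 mul1r (mulrC d) mul_polyC LZ !hornerE.
have : 0 < (y ^+ 2 - 1) * (p1.[y] * L d).
  rewrite mulrA -(ltrD2l (c1 / c0)) addr0 -Wp1.
  rewrite ltr_pdivrMr // mulrAC ltr_pdivlMr // -!expr2.
  by rewrite ltr_pXn2r ?nnegrE ?(ltW c0_gt0) ?(ltW c1_gt0) // lead_coef_lt.
rewrite pmulr_rgt0; last by rewrite subr_gt0 exprn_egt1.
move=> H; have := mulr_gt0 Ld H.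
have -> : d.[y] * L d * (p1.[y] * L d) = (p1.[y] * d.[y]) * L d ^+ 2 by ring.
rewrite pmulr_lgt0 // exprn_even_gt0 //=.
by apply: contraTneq Ld => ->; rewrite mulr0 ltxx.
Qed.

(** [c1 p0 - c0 (X - 1) p1] is orthogonal to lower degrees for the weight [x+1], since
[(x+1)(x-1) = x^2-1], and has negative leading coefficient by [lead_coef_lt].  Its
sign left of the support is thus known, and that sign is the comparison. *)
Lemma ortho_ratio_bound z : 1 <= z ->
  [/\ 0 < (-1) ^+ n.+1 * p0.[- z], 0 < (-1) ^+ n * p1.[- z]
    & c0 * (1 + z) * ((-1) ^+ n * p1.[- z]) < c1 * ((-1) ^+ n.+1 * p0.[- z])].
Proof.
move=> z1; have z1' : - z <= 1 by lra.
have H0 := ortho_sign posL pos_weight1 s0 o0 z1'.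
have H1 := ortho_sign posL pos_weight_X2 s1 o1 z1'.
split.
- by move: H0; rewrite mulrAC pmulr_lgt0.
- by move: H1; rewrite mulrAC pmulr_lgt0.
pose t := c1 *: p0 - c0 *: (('X - 1) * p1).
have sXp1 : (size ('X + 1 : {poly R})%R <= 2)%N.
  by rewrite size_XaddC.
have sX : (size ('X - 1 : {poly R})%R <= 2)%N by rewrite size_XsubC.
have tE q : (size q <= n.+1)%N ->
    L (('X + 1) * t * q) = (c1 / c0 - c0 / c1) * q`_n.
  move=> sq.
  have -> : ('X + 1) * t * q =
     c1 *: (p0 * (('X + 1) * q)) - c0 *: (('X^2 - 1) * p1 * q).
    by rewrite /t -!mul_polyC; ring.
  have sz : (size (('X + 1) * q)%R <= n.+2)%N by exact: (size_mul_le sXp1 sq).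
  rewrite LB !LZ Lp1 // Lp0 //.
  rewrite -[n.+1]/(1 + n)%N coefM_top // coefD coefX coefC addr0 mul1r.
  by ring.
have neg : c1 / c0 - c0 / c1 < 0.
  rewrite subr_lt0 ltr_pdivrMr // mulrAC ltr_pdivlMr // -!expr2.
  by rewrite ltr_pXn2r ?nnegrE ?(ltW c0_gt0) ?(ltW c1_gt0) // lead_coef_lt.
have st : (size t <= n.+1)%N.
  apply: size_le_coef0.
    rewrite (leq_trans (size_polyD _ _)) // geq_max size_polyN.
    rewrite !(leq_trans (size_scale_leq _ _)) ?s0 //.
    by rewrite -[n.+2]/(1 + n).+1 size_mul_le ?s1.
  rewrite coefB !coefZ c0E -[n.+1]/(1 + n)%N coefM_top ?s1 // c1E.
  by rewrite coefB coefX coef1 subr0 mul1r mulrC subrr.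
have t0 : t != 0.
  apply: contraTneq neg => t0; have := tE 'X^n.
  rewrite size_polyXn coefXn eqxx mulr1 t0 mulr0 mul0r functional0 // => <- //.
  by rewrite ltxx.
have tn : t`_n < 0.
  have := functional_sqr_gt0 posL pos_weight_Xp1 t0.
  by rewrite tE // nmulr_rgt0.
have st' : size t = n.+1.
  apply/eqP; rewrite eqn_leq st ltnNge; apply: contraTN tn => st'.
  by rewrite nth_default ?ltxx.
have ot : ortho_lower L ('X + 1) n t.
  by move=> q sq; rewrite tE ?nth_default ?mulr0 // ltnW.
have := ortho_sign posL pos_weight_Xp1 st' ot z1'.
rewrite /lead_coef st' /= mulrAC nmulr_lgt0 //.
move=> H; rewrite -subr_gt0.
have -> : c1 * ((-1) ^+ n.+1 * p0.[- z]) - c0 * (1 + z) * ((-1) ^+ n * p1.[- z])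
    = - ((-1) ^+ n * t.[- z]).
  rewrite /t hornerD hornerN !hornerZ hornerM hornerD hornerN hornerX hornerC.
  by rewrite exprS; ring.
by rewrite oppr_gt0.
Qed.

End OrthonormalPair.

(** * Zeros of Q and the weak eigenvalue relation *)

Section PairZeros.
Context {R : rcfType}.
Implicit Types (p q r d W f g phi psi : {poly R}) (x c z y a b : R).
Variable L : {poly R} -> R.
Hypothesis posL : pos_functional L.
Let LD := functionalD posL.
Let LZ := functionalZ posL.
Let LB := functionalB posL.

Variables (n : nat) (p0 p1 : {poly R}).
Hypotheses (on0 : orthonormal_at L 1 n.+1 p0)
  (on1 : orthonormal_at L ('X^2 - 1) n p1).

Let c0 := lead_coef p0.
Let c1 := lead_coef p1.
Let s0 : size p0 = n.+2. Proof. by case: on0. Qed.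
Let s1 : size p1 = n.+1. Proof. by case: on1. Qed.
Let c0_gt0 : 0 < c0. Proof. by case: on0. Qed.
Let c1_gt0 : 0 < c1. Proof. by case: on1. Qed.
Let o0 : ortho_lower L 1 n.+1 p0. Proof. by case: on0. Qed.
Let p0_neq0 : p0 != 0. Proof. by rewrite -size_poly_eq0 s0. Qed.

Lemma sign_mul_gt0 m (u v : R) : 0 < (-1) ^+ m * u -> 0 < (-1) ^+ m * v -> 0 < u * v.
Proof.
move=> uP vP; have := mulr_gt0 uP vP.
by rewrite mulrACA -expr2 sqrr_sign mul1r.
Qed.

(** At a zero [y] of [p0] the value of [Q] is [p0(-y) p1(y)], where [p0(-y)] has a
constant sign and [p1(y)] alternates by interlacing. *)
Lemma Qpair_root_between a b : root p0 a -> root p0 b -> a < b ->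
    (forall x, a < x < b -> ~~ root p0 x) ->
  exists c, (a < c < b) && root (Qpair p0 p1) c.
Proof.
move=> ra rb ab nr.
have ba0 : b - a != 0 by rewrite subr_eq0 gt_eqF.
have /factor_theorem[d dE] := ra.
have /factor_theorem[e eE] : root d b.
  by move: rb; rewrite dE rootM root_XsubC -subr_eq0 (negbTE ba0) orbF.
(* with p0 = e (X - a) (X - b), e has the same sign at both ends *)
have dE' : p0 = (e * ('X - a%:P)) * ('X - b%:P) by rewrite dE eE mulrAC.
have := interlace posL on0 on1 dE; rewrite eE hornerM hornerXsubC => ia.
have := interlace posL on0 on1 dE'; rewrite hornerM hornerXsubC => ib.
have eab : 0 < e.[a] * e.[b].
  rewrite ltNge; apply/negP => /(polyrcf.poly_ivt (ltW ab))[c].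
  rewrite in_itv /= !le_eqVlt => /andP[/predU1P[<-|ac]].
    by move=> _ /rootP ea; move: ia; rewrite ea mul0r mulr0 ltxx.
  move=> /predU1P[->|cb] /rootP ec.
    by move: ib; rewrite ec mul0r mulr0 ltxx.
  have := nr c; rewrite ac cb => /(_ isT); rewrite dE eE !rootM.
  by rewrite rootE ec eqxx.
have p1ab : p1.[a] * p1.[b] < 0.
  have := mulr_gt0 ia ib.
  have -> : p1.[a] * (e.[a] * (a - b)) * (p1.[b] * (e.[b] * (b - a))) =
    - (p1.[a] * p1.[b]) * (e.[a] * e.[b] * (b - a) ^+ 2) by ring.
  by rewrite pmulr_lgt0 ?oppr_gt0 // mulr_gt0 // exprn_even_gt0.
have a1 := ortho_root_gt1 posL pos_weight1 s0 o0 ra.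
have b1 := ortho_root_gt1 posL pos_weight1 s0 o0 rb.
have [pa _ _] := ortho_ratio_bound posL on0 on1 (ltW a1).
have [pb _ _] := ortho_ratio_bound posL on0 on1 (ltW b1).
have : (Qpair p0 p1).[a] * (Qpair p0 p1).[b] < 0.
  rewrite !Qpair_horner (rootP ra) (rootP rb) !mul0r !add0r mulrACA.
  by rewrite pmulr_rlt0 // (sign_mul_gt0 pa pb).
move/(poly_ivtoo (ltW ab)) => [c]; rewrite in_itv /= => cab rc.
by exists c; rewrite cab.
Qed.

Lemma Qpair_neq0 : Qpair p0 p1 != 0.
Proof.
have sr := ortho_size_rootsR posL pos_weight1 s0 o0.
have [a ra] : exists a, root p0 a.
  exists (nth 0 (rootsR p0) 0); rewrite -in_rootsR // mem_nth // sr //.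
have a1 := ortho_root_gt1 posL pos_weight1 s0 o0 ra.
have [pa _ _] := ortho_ratio_bound posL on0 on1 (ltW a1).
have /factor_theorem[d dE] := ra.
have ia := interlace posL on0 on1 dE.
apply: contraTneq (ia) => Q0; have := Qpair_horner p0 p1 a.
rewrite Q0 horner0 (rootP ra) mul0r add0r => /esym/eqP.
rewrite mulf_eq0 => /orP[/eqP pa0|/eqP ->]; last by rewrite mul0r ltxx.
by move: pa; rewrite pa0 mulr0 ltxx.
Qed.

Definition zeros_gt1 q := [seq x <- rootsR q | 1 < x].

Lemma zeros_gt1_sorted q : sorted <%R (zeros_gt1 q).
Proof. by rewrite sorted_filter ?sorted_roots //; apply: lt_trans. Qed.

Lemma mem_zeros_gt1 q x : q != 0 -> (x \in zeros_gt1 q) = (1 < x) && root q x.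
Proof. by move=> q0; rewrite mem_filter in_rootsR. Qed.

(** The two terms of degree [2n+1] cancel. *)
Lemma size_Qpair : (size (Qpair p0 p1) <= n.*2.+1)%N.
Proof.
have sN p : size (p \Po - 'X) = size p.
  by rewrite size_comp_poly2 // size_polyN size_polyX.
apply: size_le_coef0.
  rewrite (leq_trans (size_polyD _ _)) // geq_max.
  have -> : n.*2.+2 = (n.+1 + n).+1 by rewrite -addnn.
  by rewrite !size_mul_le ?sN ?s0 ?s1.
have -> : n.*2.+1 = (n.+1 + n)%N by rewrite -addnn.
rewrite coefD !coefM_top ?sN ?s0 ?s1 // !coef_compN exprS; ring.
Qed.

Lemma zeros_gt1_pm :
  all (root (Qpair p0 p1))
    (zeros_gt1 (Qpair p0 p1) ++ map -%R (zeros_gt1 (Qpair p0 p1))) /\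
  uniq (zeros_gt1 (Qpair p0 p1) ++ map -%R (zeros_gt1 (Qpair p0 p1))).
Proof.
have Q0 := Qpair_neq0; set Q := Qpair p0 p1 in Q0 *.
have uz : uniq (zeros_gt1 Q) by rewrite filter_uniq // uniq_roots.
split.
  rewrite all_cat all_map; apply/andP; split; apply/allP => x;
    rewrite mem_zeros_gt1 // => /andP[_] // /rootP rx /=.
  by rewrite rootE Qpair_horner opprK addrC -Qpair_horner -/Q rx.
rewrite cat_uniq uz map_inj_uniq ?uz ?andbT; last exact: oppr_inj.
apply/hasPn => _ /mapP[x + ->]; rewrite !mem_zeros_gt1 // => /andP[x1 _].
by apply/negP => /andP[x2 _]; lra.
Qed.

(** The zeros beyond 1 and their opposites are at most [deg Q <= 2n] in number, and
the [n] gaps between the zeros of [p0] contain at least one zero each. *)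
Lemma size_zeros_gt1 : size (zeros_gt1 (Qpair p0 p1)) = n.
Proof.
have Q0 := Qpair_neq0; have [allr uniqr] := zeros_gt1_pm.
set Q := Qpair p0 p1 in Q0 allr uniqr *.
apply/eqP; rewrite eqn_leq; apply/andP; split.
  have := max_poly_roots Q0 allr uniqr.
  rewrite size_cat size_map addnn => /leq_trans/(_ size_Qpair).
  by rewrite ltnS leq_double.
have sr := ortho_size_rootsR posL pos_weight1 s0 o0.
set rs := rootsR p0 in sr.
have srs : sorted <%R rs by exact: sorted_roots.
have mono i j : (i < n.+1)%N -> (j < n.+1)%N ->
    (nth 0 rs i < nth 0 rs j) = (i < j)%N.
  by move=> ni nj; rewrite (lt_sorted_ltn_nth 0 srs) ?inE ?sr.
have rr i : (i < n.+1)%N -> root p0 (nth 0 rs i).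
  by move=> ni; rewrite -in_rootsR // mem_nth // sr.
have H (i : 'I_n) : exists c, (nth 0 rs i < c < nth 0 rs i.+1) && root Q c.
  have ni := ltn_ord i.
  apply: Qpair_root_between; rewrite ?rr ?mono ?(ltnW ni) //; first by rewrite ltnS ltnW.
    by rewrite ltnS ltnW.
  move=> x /andP[ix xi]; rewrite -in_rootsR //; apply/negP => /(nthP 0)[k].
  rewrite -/rs sr => nk xE; move: ix xi; rewrite -xE !mono ?ltnS ?(ltnW ni) //.
  by lia.
have [r rP] := fin_all_exists H.
have rlt (i j : 'I_n) : (i < j)%N -> r i < r j.
  move=> ij; have /andP[/andP[_ h1] _] := rP i; have /andP[/andP[h2 _] _] := rP j.
  apply: lt_trans h1 _; apply: le_lt_trans h2.
  by rewrite leNgt mono -?leqNgt // ltnS // ltnW.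
rewrite -[leqLHS](card_ord n) cardE -(size_map r); apply: uniq_leq_size.
  rewrite map_inj_uniq ?enum_uniq // => i j rij; apply/val_inj/eqP.
  by case: ltngtP => // /rlt; rewrite rij ltxx.
move=> _ /mapP[i _ ->]; rewrite mem_zeros_gt1 //.
have /andP[/andP[ir _] ->] := rP i; rewrite andbT.
apply: lt_trans ir; apply: (ortho_root_gt1 posL pos_weight1 s0 o0).
by rewrite rr // ltnS ltnW.
Qed.

(** The zeros are simple, as [Q] already has [2n] distinct ones. *)
Lemma Qpair_sign_change z a b : z \in zeros_gt1 (Qpair p0 p1) -> 1 < a -> a < z < b ->
  (forall x, x \in zeros_gt1 (Qpair p0 p1) -> a <= x <= b -> x = z) ->
  (Qpair p0 p1).[a] * (Qpair p0 p1).[b] < 0.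
Proof.
have Q0 := Qpair_neq0; have [allr uniqr] := zeros_gt1_pm.
have szQ := size_zeros_gt1; have sQ := size_Qpair.
set Q := Qpair p0 p1 in Q0 allr uniqr szQ sQ *.
move=> zz a1 /andP[az zb] iso.
have /andP[z1 /factor_theorem[e eE]] : (1 < z) && root Q z by rewrite -mem_zeros_gt1.
have e0 : e != 0 by apply: contraNneq Q0 => e0; rewrite eE e0 mul0r.
have ez : ~~ root e z.
  apply/negP => ez; have alle : all (root e) (zeros_gt1 Q ++ map -%R (zeros_gt1 Q)).
    apply/allP => x /(allP allr); rewrite eE rootM root_XsubC => /orP[//|/eqP ->].
    exact: ez.
  have := max_poly_roots e0 alle uniqr; rewrite size_cat size_map szQ addnn => lt.
  move: sQ; rewrite eE size_mul ?polyXsubC_eq0 // size_XsubC addn2 ltnS.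
  by rewrite leqNgt lt.
have eab : 0 < e.[a] * e.[b].
  rewrite ltNge; apply/negP => /(polyrcf.poly_ivt (ltW (lt_trans az zb)))[c].
  rewrite in_itv /= => cab ec.
  have cz : c \in zeros_gt1 Q.
    rewrite mem_zeros_gt1 // eE rootM ec andbT (lt_le_trans a1) //.
    by case/andP: cab.
  by move: ez; rewrite -(iso c cz cab) ec.
rewrite eE !hornerM !hornerXsubC mulrACA pmulr_rlt0 // nmulr_rlt0 ?subr_gt0 //.
by rewrite subr_lt0.
Qed.

Lemma ortho_unique W m p r : pos_weight W -> orthonormal_at L W m p ->
  (size r <= m.+1)%N -> ortho_lower L W m r -> r = (r`_m / lead_coef p) *: p.
Proof.
move=> Wp [sp lp op np] sr or; set k := _ / _.
have pn : p`_m = lead_coef p by rewrite /lead_coef sp.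
have se : (size (r - k *: p)%R <= m)%N.
  apply: size_le_coef0.
    rewrite (leq_trans (size_polyD _ _)) // geq_max sr size_polyN.
    by rewrite (leq_trans (size_scale_leq _ _)) // sp.
  by rewrite coefB coefZ pn divfK ?subrr // gt_eqF.
apply/eqP; rewrite -subr_eq0; apply: contraT => e0.
have := functional_sqr_gt0 posL Wp e0.
rewrite [W * _]mulrBr mulrBl LB (or _ se) -scalerAr -scalerAl LZ (op _ se).
by rewrite mulr0 subrr ltxx.
Qed.

(** The relation [A1 y = lam A0 y] tested against all vectors, for the
polynomials [f] and [g] whose coordinates are the two blocks of [y].  It makes
sense for every functional and involves no choice of basis, which is what allows
to compare different parameters. *)
Definition eigen_pair lam f g : Prop :=
  (forall phi, (size phi <= n.+1)%N ->
     L (('X^2 - 1) * g * phi) = lam * L ('X * f * phi)) /\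
  (forall psi, (size psi <= n)%N ->
     L (('X^2 - 1) * f * psi) = lam * L ('X * ('X^2 - 1) * g * psi)).

(** With [k = c/c'] and [al = - m k be], the expression is [be^2] times
[l (1 + k^2 m^2) - m (k^2 + 1)] where [l = s/z], that is
[(l (1 + m^2) - 2 m) + (1 - k^2) m (1 - l m)].  The first term is nonnegative for
[m <= s/(1+z)], because [l = 2 tau/(1 + tau^2)] with [tau = s/(1+z)]. *)
Lemma markov_inequality (c c' s z a b al be : R) :
  0 < c -> c < c' -> 1 < z -> 0 <= s -> s ^+ 2 = z ^+ 2 - 1 ->
  0 < a -> 0 < b -> c' * (1 + z) * b < c * a -> al * a = - (s * be * b) ->
  be != 0 ->
  0 < s / z * (al ^+ 2 + be ^+ 2) + al * be * (c / c' + c' / c).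
Proof.
move=> cp cc z1 sp sE ap bp H alE be0.
have c'p : 0 < c' by apply: lt_trans cc.
have zp : 0 < z by lra.
have sgt : 0 < s.
  by rewrite lt_def sp andbT; apply: contraTneq z1 => sz0; rewrite -leNgt; nra.
pose m := s * b * c' / (a * c).
have mp : 0 < m by rewrite divr_gt0 ?mulr_gt0.
pose k := c / c'.
have kp : 0 < k by rewrite divr_gt0.
have k1 : k < 1 by rewrite ltr_pdivrMr // mul1r.
have mt : m * (1 + z) < s.
  rewrite mulrAC ltr_pdivrMr ?mulr_gt0 //.
  have -> : s * b * c' * (1 + z) = s * (c' * (1 + z) * b) by ring.
  by rewrite [a * c]mulrC ltr_pM2l.
have alE' : al = - (m * k * be).
  apply: (mulIf (lt0r_neq0 ap)); rewrite alE /m /k; field.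
  by rewrite !gt_eqF.
rewrite -[c' / c]invf_div -/k alE'.
have -> : s / z * ((- (m * k * be)) ^+ 2 + be ^+ 2) + - (m * k * be) * be * (k + k^-1)
  = be ^+ 2 * (s / z * (1 + k ^+ 2 * m ^+ 2) - m * (k ^+ 2 + 1)).
  by field; rewrite !gt_eqF.
rewrite pmulr_rgt0 ?exprn_even_gt0 //.
set l := s / z.
have lz : l * z = s by rewrite divfK // gt_eqF.
have lp : 0 < l by rewrite divr_gt0.
have sz : s < z by rewrite -(ltr_pXn2r (_ : 0 < 2)%N) ?nnegrE //; lra.
have l1 : l < 1 by rewrite ltr_pdivrMr // mul1r.
have m1 : m < 1 by nra.
have lm : 0 <= l * (1 + m ^+ 2) - 2 * m.
  have : 0 <= (s - m * (1 + z)) * (1 + z - s * m) by rewrite mulr_ge0 //; nra.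
  have -> : (s - m * (1 + z)) * (1 + z - s * m) =
     s * (1 + z) * (1 + m ^+ 2) - m * ((1 + z) ^+ 2 + s ^+ 2) by ring.
  rewrite sE -lz.
  have -> : l * z * (1 + z) * (1 + m ^+ 2) - m * ((1 + z) ^+ 2 + (z ^+ 2 - 1))
     = (z * (1 + z)) * (l * (1 + m ^+ 2) - 2 * m) by ring.
  by rewrite pmulr_rge0 // mulr_gt0 //; lra.
have -> : l * (1 + k ^+ 2 * m ^+ 2) - m * (k ^+ 2 + 1) =
   (l * (1 + m ^+ 2) - 2 * m) + (1 - k ^+ 2) * (m * (1 - l * m)) by ring.
apply: ltr_wpDl => //; apply: mulr_gt0; first by rewrite subr_gt0 expr_lt1 // ltW.
rewrite mulr_gt0 // subr_gt0; nra.
Qed.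

(** This is minus the numerator of the derivative of the eigenvalue.  The two defects
[(X^2-1) g - l X f] and [f - l X g] are multiples [al p0] and [be p1], which
reduces the quantity to their leading coefficients; evaluating both at [-z], where
[l z = s], gives [al p0(-z) = s be p1(-z)]. *)
Lemma eigen_pair_markov z s f g : 1 < z -> 0 <= s -> s ^+ 2 = z ^+ 2 - 1 ->
  (size f <= n.+1)%N -> (size g <= n)%N -> eigen_pair (s / z) f g ->
  (f != 0) || (g != 0) ->
  0 < L ('X * (('X^2 - 1) * (2 *: (f * g))) -
         (s / z) *: ('X * ('X * (f * f + ('X^2 - 1) * (g * g))))).
Proof.
move=> z1 sp sE sf sg [e1 e2] fg; set l := s / z in e1 e2 *.
have zp : 0 < z by lra.
have lz : l * z = s by rewrite divfK // gt_eqF.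
have sz : s < z by rewrite -(ltr_pXn2r (_ : 0 < 2)%N) ?nnegrE //; lra.
have l0 : 0 <= l by rewrite divr_ge0 // ltW.
have l1 : l < 1 by rewrite ltr_pdivrMr // mul1r.
have sX : (size ('X : {poly R}) <= 2)%N by rewrite size_polyX.
have sW : (size ('X^2 - 1 : {poly R})%R <= 3)%N by rewrite size_XnsubC.
have sXf : (size ('X * f)%R <= n.+2)%N := size_mul_le sX sf.
have sXg : (size ('X * g)%R <= n.+1)%N.
  by rewrite (leq_trans (size_polyMleq _ _)) // size_polyX.
have sWg : (size (('X^2 - 1) * g)%R <= n.+2)%N.
  by rewrite (leq_trans (size_polyMleq _ _)) // size_XnsubC.
pose r0 := ('X^2 - 1) * g - l *: ('X * f).
pose r1 := f - l *: ('X * g).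
have sr0 : (size r0 <= n.+2)%N.
  rewrite (leq_trans (size_polyD _ _)) // geq_max sWg size_polyN.
  by rewrite (leq_trans (size_scale_leq _ _)).
have sr1 : (size r1 <= n.+1)%N.
  rewrite (leq_trans (size_polyD _ _)) // geq_max sf size_polyN.
  by rewrite (leq_trans (size_scale_leq _ _)).
have or0 : ortho_lower L 1 n.+1 r0.
  by move=> phi /e1 E; rewrite mul1r mulrBl -scalerAl LB LZ E subrr.
have or1 : ortho_lower L ('X^2 - 1) n r1.
  move=> psi /e2 E; rewrite mulrBr mulrBl -scalerAr -scalerAl LB LZ E.
  by rewrite [('X^2 - 1) * _]mulrA [('X^2 - 1) * 'X]mulrC subrr.
have := ortho_unique pos_weight1 on0 sr0 or0.
have := ortho_unique pos_weight_X2 on1 sr1 or1.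
rewrite -/c0 -/c1; set be := _ / c1; set al := _ / c0 => r1E r0E.
pose U := f`_n; pose V := ('X * g)`_n.
have alE : al * c0 = V - l * U.
  rewrite divfK ?gt_eqF // coefB coefZ mulrBl mul1r coefB coefXM /=.
  rewrite [g`_n.+1]nth_default ?subr0; last by rewrite (leq_trans sg).
  by rewrite expr2 -mulrA coefXM.
have beE : be * c1 = U - l * V by rewrite divfK ?gt_eqF // coefB coefZ.
have -> : 'X * (('X^2 - 1) * (2 *: (f * g))) -
         l *: ('X * ('X * (f * f + ('X^2 - 1) * (g * g)))) =
    al *: (1 * p0 * ('X * f)) + be *: (('X^2 - 1) * p1 * ('X * g)).
  rewrite mul1r [al *: _]scalerAl [be *: _]scalerAl [be *: _]scalerAr -r0E -r1E /r0 /r1.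
  by rewrite -!mul_polyC; ring.
rewrite LD !LZ (orthonormal_coef posL on0) // (orthonormal_coef posL on1) //.
rewrite coefXM /= -/U -/V -/c0 -/c1.
have [pa pb ab] := ortho_ratio_bound posL on0 on1 (ltW z1).
set a := _ * p0.[_] in pa ab; set b := _ * p1.[_] in pb ab.
have /(congr1 (fun p => p.[- z])) := r0E.
have /(congr1 (fun p => p.[- z])) := r1E.
rewrite /r0 /r1 !hornerZ !hornerD !hornerN !hornerZ !hornerM !hornerD !hornerN hornerXn hornerX hornerC.
move=> h1 h0.
have ab' : al * a = - (s * be * b).
  rewrite /a /b exprS.
  have -> : al * (-1 * (-1) ^+ n * p0.[- z]) = - (-1) ^+ n * (al * p0.[- z]) by ring.
  have -> : s * be * ((-1) ^+ n * p1.[- z]) = (-1) ^+ n * (s * (be * p1.[- z])) by ring.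
  by rewrite -h0 -h1 sqrrN -sE -lz; ring.
have be0 : be != 0.
  apply: contraTneq fg => be0.
  have al0 : al = 0.
    apply: (mulIf (lt0r_neq0 pa)); rewrite ab' be0; ring.
  have fE : f = l *: ('X * g).
    by apply/eqP; rewrite -subr_eq0 -/r1 r1E be0 scale0r.
  have : r0 = 0 by rewrite r0E al0 scale0r.
  have -> : r0 = ('X^2 - 1 - l ^+ 2 *: 'X^2) * g.
    by rewrite /r0 fE -!mul_polyC; ring.
  move=> /eqP.
  rewrite mulf_eq0 => /orP[|/eqP g0]; last by rewrite fE g0 mulr0 scaler0 eqxx.
  move=> /eqP/(congr1 (fun p => p`_0))/eqP.
  rewrite !coefB coefZ coefXn coef1 coef0 /= mulr0 subr0 sub0r oppr_eq0 oner_eq0 //.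
have c01 : c1 < c0 by apply: (lead_coef_lt posL on0 on1).
have := markov_inequality c1_gt0 c01 z1 sp sE pa pb ab ab' be0.
rewrite -/l.
have -> : l * (al ^+ 2 + be ^+ 2) + al * be * (c1 / c0 + c0 / c1) =
   (1 - l ^+ 2) * (al * (U / c0) + be * (V / c1)).
  have -> : (1 - l ^+ 2) * (al * (U / c0) + be * (V / c1)) =
    al * ((U - l * V) + l * (V - l * U)) / c0 + be * ((V - l * U) + l * (U - l * V)) / c1.
    by ring.
  rewrite -alE -beE; field; by rewrite !gt_eqF.
by rewrite pmulr_rgt0 // subr_gt0 expr_lt1.
Qed.

Lemma eigen_pair_norm_gt0 f g : (f != 0) || (g != 0) ->
  0 < L ('X * (f * f + ('X^2 - 1) * (g * g))).
Proof.
move=> fg; apply: functional_gt0 => //; last first.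
  move=> x x1; rewrite hornerM hornerX mulr_ge0 ?(le_trans ler01 (ltW x1)) //.
  rewrite hornerD hornerM hornerM hornerM -!expr2 addr_ge0 ?sqr_ge0 //.
  by apply: mulr_ge0; rewrite ?sqr_ge0 // ltW // pos_weight_X2.
have : 0 < L (f * f + ('X^2 - 1) * (g * g)).
  rewrite LD.
  have Lf : 0 <= L (f * f).
    by apply: functional_ge0 => // x _; rewrite hornerM -expr2 sqr_ge0.
  have Lg : 0 <= L (('X^2 - 1) * (g * g)).
    apply: functional_ge0 => // x x1; rewrite hornerM hornerM -expr2.
    by apply: mulr_ge0; rewrite ?sqr_ge0 // ltW // pos_weight_X2.
  case/orP: fg => [f0|g0].
    apply: ltr_wpDr => //.
    by have := functional_sqr_gt0 posL pos_weight1 f0; rewrite mul1r.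
  apply: ltr_wpDl => //; rewrite mulrA.
  exact: (functional_sqr_gt0 posL pos_weight_X2 g0).
move=> H; rewrite mulf_neq0 ?polyX_eq0 //; apply: contraTneq H => ->.
by rewrite functional0 // ltxx.
Qed.

End PairZeros.

(** * Reproducing kernels and the eigenvectors *)

Section Families.
Context {R : rcfType}.
Implicit Types (p q r d W f g phi psi : {poly R}) (x c z y a b : R).
Variable L : {poly R} -> R.
Hypothesis posL : pos_functional L.
Let LD := functionalD posL.
Let LZ := functionalZ posL.
Let LB := functionalB posL.

Definition orthonormal_family W (P : nat -> {poly R}) : Prop :=
  (forall n, size (P n) = n.+1 /\ 0 < lead_coef (P n)) /\
  (forall i j, L (W * P i * P j) = (i == j)%:R).

(** Represents the evaluation [q |-> q(a)] on polynomials of degree less than [m]. *)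
Definition kernel (P : nat -> {poly R}) m a : {poly R} :=
  \sum_(k < m) (P k).[a] *: P k.

Section OneFamily.
Variables (W : {poly R}) (P : nat -> {poly R}).
Hypothesis onP : orthonormal_family W P.

Lemma family_expand m q : (size q <= m)%N ->
  exists c : nat -> R, q = \sum_(k < m) c k *: P k.
Proof.
elim: m q => [|m IH] q sq.
  by exists (fun=> 0); rewrite big_ord0; apply/eqP; rewrite -size_poly_leq0.
have [sP lP] := onP.1 m.
have Pm : (P m)`_m = lead_coef (P m) by rewrite /lead_coef sP.
have [|c cE] := IH (q - (q`_m / lead_coef (P m)) *: P m).
  apply: size_le_coef0.
    rewrite (leq_trans (size_polyD _ _)) // geq_max sq size_polyN.
    by rewrite (leq_trans (size_scale_leq _ _)) // sP.
  by rewrite coefB coefZ Pm divfK ?subrr // gt_eqF.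
exists (fun k => if k == m then q`_m / lead_coef (P m) else c k).
rewrite big_ord_recr /= eqxx.
under eq_bigr => k _ do rewrite lt_eqF ?ltEnat ?ltn_ord //=.
by rewrite -cE subrK.
Qed.

Lemma family_orthonormal_at n : orthonormal_at L W n (P n).
Proof.
have [sP lP] := onP.1 n; split=> //; last by rewrite onP.2 eqxx.
move=> q /family_expand[c ->].
rewrite mulr_sumr functional_sum // big1 // => k _.
by rewrite -scalerAr LZ onP.2 gt_eqF ?mulr0 // ltEnat /= ltn_ord.
Qed.

Lemma family_coef n q : (size q <= n.+1)%N ->
  L (W * P n * q) = q`_n / lead_coef (P n).
Proof. exact/orthonormal_coef/family_orthonormal_at. Qed.

Lemma kernel_eval m a q : (size q <= m)%N -> L (W * kernel P m a * q) = q.[a].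
Proof.
move=> /family_expand[c ->].
rewrite horner_sum mulr_sumr functional_sum //; apply: eq_bigr => k _.
rewrite -scalerAr LZ hornerZ mulr_sumr mulr_suml functional_sum //.
rewrite (bigD1 k) //= big1 => [|j jk].
  by rewrite addr0 -scalerAr -scalerAl LZ onP.2 eqxx mulr1.
by rewrite -scalerAr -scalerAl LZ onP.2 val_eqE (negbTE jk) mulr0.
Qed.

(** One degree too many costs a boundary term proportional to [(P m).[a]]; these terms
are the source of the equation [Q(z) = 0]. *)
Lemma kernel_eval_next m a q : (size q <= m.+1)%N ->
  L (W * kernel P m a * q) = q.[a] - q`_m / lead_coef (P m) * (P m).[a].
Proof.
move=> sq; have [sP lP] := onP.1 m.
have Pm : (P m)`_m = lead_coef (P m) by rewrite /lead_coef sP.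
set k := _ / _.
have sr : (size (q - k *: P m)%R <= m)%N.
  apply: size_le_coef0.
    rewrite (leq_trans (size_polyD _ _)) // geq_max sq size_polyN.
    by rewrite (leq_trans (size_scale_leq _ _)) // sP.
  by rewrite coefB coefZ Pm divfK ?subrr // gt_eqF.
have := kernel_eval a sr.
rewrite hornerD hornerN hornerZ mulrBr LB -scalerAr LZ => <-.
suff -> : L (W * kernel P m a * P m) = 0 by rewrite mulr0 subr0.
rewrite mulr_sumr mulr_suml functional_sum // big1 // => j _.
by rewrite -scalerAr -scalerAl LZ onP.2 lt_eqF ?mulr0 // ltEnat /= ltn_ord.
Qed.

Hypothesis Wp : pos_weight W.

(** [P n] is an explicit function of the lower members and of values of [L]; this is how
regularity in the parameter propagates along the family. *)
Lemma gram_schmidt n : let r := 'X^n - \sum_(k < n) L (W * P k * 'X^n) *: P k in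
  0 < L (W * r * r) /\ P n = (Num.sqrt (L (W * r * r)))^-1 *: r.
Proof.
set s := \sum_(k < n) _ => r.
have ss : (size s <= n)%N.
  apply: (leq_trans (size_sum _ _ _)); apply/bigmax_leqP => k _.
  by rewrite (leq_trans (size_scale_leq _ _)) // (onP.1 k).1.
have rn : r`_n = 1 by rewrite coefB coefXn eqxx nth_default ?subr0.
have sr : (size r <= n.+1)%N.
  rewrite (leq_trans (size_polyD _ _)) // geq_max size_polyXn size_polyN.
  by rewrite leqnn leqW.
have or : ortho_lower L W n r.
  move=> q /family_expand[c ->]; rewrite mulr_sumr functional_sum // big1 // => k _.
  rewrite -scalerAr LZ; suff -> : L (W * r * P k) = 0 by rewrite mulr0.
  have -> : W * r * P k = W * P k * 'X^n - W * P k * s by rewrite /r; ring.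
  rewrite LB mulr_sumr functional_sum // (bigD1 k) //= big1 => [|j jk].
    by rewrite -scalerAr LZ onP.2 eqxx mulr1 addr0 subrr.
  by rewrite -scalerAr LZ onP.2 val_eqE eq_sym (negbTE jk) mulr0.
have on := family_orthonormal_at n.
have lp : 0 < lead_coef (P n) by case: on.
have rE := ortho_unique posL Wp on sr or; rewrite rn div1r in rE.
have N : L (W * r * r) = (lead_coef (P n))^-1 ^+ 2.
  by rewrite rE -!scalerAr -scalerAl !LZ onP.2 eqxx mulr1 expr2.
split; first by rewrite N exprn_gt0 // invr_gt0.
rewrite N sqrtr_sqr ger0_norm ?invr_ge0 ?ltW // invrK rE scalerA divff ?scale1r //.
by rewrite gt_eqF.
Qed.

End OneFamily.

Variables (P0 P1 : nat -> {poly R}) (n : nat).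
Hypotheses (on0 : orthonormal_family 1 P0)
  (on1 : orthonormal_family ('X^2 - 1) P1).

Definition eigen_f z : {poly R} :=
  (P1 n).[- z] *: kernel P0 n.+1 z + (P1 n).[z] *: kernel P0 n.+1 (- z).

Definition eigen_g z : {poly R} := Num.sqrt (z ^+ 2 - 1) *:
  ((P1 n).[- z] *: kernel P1 n z - (P1 n).[z] *: kernel P1 n (- z)).

Lemma size_kernel W (P : nat -> {poly R}) m a :
  orthonormal_family W P -> (size (kernel P m a) <= m)%N.
Proof.
move=> onP; apply: (leq_trans (size_sum _ _ _)); apply/bigmax_leqP => k _.
by rewrite (leq_trans (size_scale_leq _ _)) // (onP.1 k).1.
Qed.

Lemma size_eigen_f z : (size (eigen_f z) <= n.+1)%N.
Proof.
rewrite (leq_trans (size_polyD _ _)) // geq_max.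
by rewrite !(leq_trans (size_scale_leq _ _)) // (size_kernel _ _ on0).
Qed.

Lemma size_eigen_g z : (size (eigen_g z) <= n)%N.
Proof.
rewrite (leq_trans (size_scale_leq _ _)) // (leq_trans (size_polyD _ _)) //.
by rewrite geq_max size_polyN !(leq_trans (size_scale_leq _ _)) // (size_kernel _ _ on1).
Qed.

(** In the first relation the boundary terms of the kernels of [P1] cancel by the choice
of the coefficients, and those of [P0] add up to a multiple of [Q(z)]; in the
second one it is the kernels of [P0] that produce [Q(z)]. *)
Lemma eigen_pair_kernel z : 1 < z ^+ 2 -> root (Qpair (P0 n.+1) (P1 n)) z ->
  eigen_pair L n (Num.sqrt (z ^+ 2 - 1) / z) (eigen_f z) (eigen_g z).
Proof.
move=> z1 /rootP; rewrite Qpair_horner => Qz.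
have z0 : z != 0 by apply: contraTneq z1 => ->; rewrite expr0n /= ltr10.
have sE : Num.sqrt (z ^+ 2 - 1) ^+ 2 = z ^+ 2 - 1 by rewrite sqr_sqrtr // subr_ge0 ltW.
rewrite /eigen_f /eigen_g; set s := Num.sqrt _ in sE *.
set be := (P1 n).[- z] in Qz *; set ga := (P1 n).[z] in Qz *.
have sX : (size ('X : {poly R}) <= 2)%N by rewrite size_polyX.
have sW : (size ('X^2 - 1 : {poly R})%R <= 3)%N by rewrite size_XnsubC.
split=> [phi sphi|psi spsi].
- have -> : ('X^2 - 1) * (s *: (be *: kernel P1 n z - ga *: kernel P1 n (- z))) * phi
   = s *: (be *: (('X^2 - 1) * kernel P1 n z * phi)
           - ga *: (('X^2 - 1) * kernel P1 n (- z) * phi)).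
    by rewrite -!mul_polyC; ring.
  have -> : 'X * (be *: kernel P0 n.+1 z + ga *: kernel P0 n.+1 (- z)) * phi
   = be *: (1 * kernel P0 n.+1 z * ('X * phi))
           + ga *: (1 * kernel P0 n.+1 (- z) * ('X * phi)).
    by rewrite -!mul_polyC; ring.
  rewrite LZ LB LD !LZ !(kernel_eval_next on1) //.
  rewrite !(kernel_eval_next on0) ?(size_mul_le sX sphi) //.
  rewrite !hornerM !hornerX -/be -/ga.
  set k := _`_n / _; set k' := _`_n.+1 / _.
  have -> : be * (z * phi.[z] - k' * (P0 n.+1).[z]) +
     ga * (- z * phi.[- z] - k' * (P0 n.+1).[- z]) =
     z * (be * phi.[z] - ga * phi.[- z]) -
     k' * ((P0 n.+1).[z] * be + (P0 n.+1).[- z] * ga) by ring.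
  rewrite Qz mulr0 subr0 mulrA divfK //; ring.
- have -> : ('X^2 - 1) * (be *: kernel P0 n.+1 z + ga *: kernel P0 n.+1 (- z)) * psi
   = be *: (1 * kernel P0 n.+1 z * (('X^2 - 1) * psi))
           + ga *: (1 * kernel P0 n.+1 (- z) * (('X^2 - 1) * psi)).
    by rewrite -!mul_polyC; ring.
  have -> : 'X * ('X^2 - 1) * (s *: (be *: kernel P1 n z - ga *: kernel P1 n (- z))) * psi
   = s *: (be *: (('X^2 - 1) * kernel P1 n z * ('X * psi))
           - ga *: (('X^2 - 1) * kernel P1 n (- z) * ('X * psi))).
    by rewrite -!mul_polyC; ring.
  have sXpsi : (size ('X * psi)%R <= n.+1)%N.
    by rewrite (leq_trans (size_polyMleq _ _)) // size_polyX.
  have sWpsi : (size (('X^2 - 1) * psi)%R <= n.+2)%N.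
    by rewrite (leq_trans (size_polyMleq _ _)) // size_XnsubC.
  rewrite LZ LB LD !LZ !(kernel_eval_next on1) // !(kernel_eval_next on0) //.
  rewrite !hornerM !hornerX !hornerD !hornerN !hornerXn !hornerC sqrrN -/be -/ga.
  set k' := _`_n / _; set k := _`_n.+1 / _.
  have -> : be * ((z ^+ 2 - 1) * psi.[z] - k * (P0 n.+1).[z]) +
     ga * ((z ^+ 2 - 1) * psi.[- z] - k * (P0 n.+1).[- z]) =
     (z ^+ 2 - 1) * (be * psi.[z] + ga * psi.[- z]) -
     k * ((P0 n.+1).[z] * be + (P0 n.+1).[- z] * ga) by ring.
  rewrite Qz mulr0 subr0 -sE.
  have -> : s * (be * (z * psi.[z] - k' * ga) - ga * (- z * psi.[- z] - k' * be))
    = z * (s * (be * psi.[z] + ga * psi.[- z])) by ring.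
  rewrite mulrA divfK //; ring.
Qed.

(** For the eigenvalue 0 the evaluation points are the zeros of [X^2 - 1] itself. *)
Lemma eigen_pair0 :
  eigen_pair L n 0 ((P0 n.+1).[- 1] *: kernel P0 n.+1 1
     - (P0 n.+1).[1] *: kernel P0 n.+1 (- 1)) 0.
Proof.
split=> [phi _|psi spsi]; first by rewrite mulr0 mul0r functional0 // mul0r.
set be := (P0 n.+1).[- 1]; set ga := (P0 n.+1).[1].
have -> : ('X^2 - 1) * (be *: kernel P0 n.+1 1 - ga *: kernel P0 n.+1 (- 1)) * psi
   = be *: (1 * kernel P0 n.+1 1 * (('X^2 - 1) * psi))
           - ga *: (1 * kernel P0 n.+1 (- 1) * (('X^2 - 1) * psi)).
  by rewrite -!mul_polyC; ring.
have sWpsi : (size (('X^2 - 1) * psi)%R <= n.+2)%N.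
  by rewrite (leq_trans (size_polyMleq _ _)) // size_XnsubC.
rewrite LB !LZ !(kernel_eval_next on0) //.
rewrite !hornerM !hornerD !hornerN !hornerXn !hornerC -/be -/ga sqrrN expr1n.
rewrite mul0r subrr; ring.
Qed.

End Families.

(** * Pencils with a full set of eigenvectors *)

Section DiagonalisedPencil.
Context {F : fieldType} {m : nat}.
Variables (A B Y : 'M[F]_m) (l : 'I_m -> F).
Hypotheses (uB : B \in unitmx) (uY : Y \in unitmx) (linj : injective l).
Hypothesis AY : A *m Y = B *m Y *m diag_mx (\row_j l j).

(** In the basis of eigenvectors the pencil is diagonal. *)
Lemma pencil_eigenvector mu (w : 'cV[F]_m) :
  A *m w = mu *: (B *m w) <-> forall j, (l j - mu) * (invmx Y *m w) j 0 = 0.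
Proof.
set x := invmx Y *m w; have wE : w = Y *m x by rewrite mulKVmx.
clearbody x; rewrite wE mulmxA AY -!mulmxA !scalemxAr.
split=> [/(can_inj (mulKmx uB))/(can_inj (mulKmx uY))/matrixP E j|E].
  have := E j 0; rewrite mul_diag_mx !mxE => e.
  by rewrite mulrBl e subrr.
congr (B *m (Y *m _)); apply/matrixP => j k.
rewrite (ord1 k) mul_diag_mx !mxE; apply/eqP; rewrite -subr_eq0 -mulrBl.
exact/eqP/E.
Qed.

Lemma pencil_eigenspace j (w : 'cV[F]_m) :
  A *m w = l j *: (B *m w) <-> exists c, w = c *: col j Y.
Proof.
rewrite pencil_eigenvector; split=> [H|[c ->] k].
  exists ((invmx Y *m w) j 0).
  have {1}-> : w = Y *m (invmx Y *m w) by rewrite mulKVmx.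
  set x := invmx Y *m w in H *; clearbody x.
  have -> : x = x j 0 *: delta_mx j 0.
    apply/matrixP => k i; rewrite (ord1 i) !mxE eqxx andbT.
    have [->|kj] := eqVneq k j; first by rewrite mulr1.
    have /eqP := H k; rewrite mulf_eq0 subr_eq0 (inj_eq linj) (negbTE kj) /=.
    by move=> /eqP ->; rewrite mulr0.
  by rewrite -scalemxAr -colE !mxE !eqxx mulr1.
rewrite -scalemxAr colE mulKmx // !mxE eqxx andbT.
by have [->|kj] := eqVneq k j; rewrite ?subrr ?mul0r ?mulr0.
Qed.

Lemma pencil_eigenvalue mu : gen_eigenvalue A B mu <-> exists j, mu = l j.
Proof.
split=> [[w w0 /pencil_eigenvector H]|[j ->]].
  have [j xj] : exists j, (invmx Y *m w) j 0 != 0.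
    apply/existsP; apply: contraNT w0; rewrite negb_exists => /forallP H0.
    rewrite -(mulKVmx uY w) (_ : invmx Y *m w = 0) ?mulmx0 //.
    apply/matrixP => k i; rewrite (ord1 i) [RHS]mxE.
    by apply/eqP; move: (H0 k); rewrite negbK.
  exists j; have /eqP := H j; rewrite mulf_eq0 (negbTE xj) orbF subr_eq0.
  by move=> /eqP.
exists (col j Y); last by apply/pencil_eigenspace; exists 1; rewrite scale1r.
apply: contraTneq uY => Yj; rewrite unitmxE unitfE negbK.
rewrite -det_tr (determinant_multilinear (i0 := j) (B := Y^T) (C := Y^T) (b := 0) (c := 0)).
- by rewrite !mul0r addr0.
- by rewrite -tr_col Yj trmx0 !scale0r addr0.
- by [].
- by [].
Qed.

Lemma char_pencil_diag :
  char_pencil A B = (\det B)%:P * \prod_j ((l j)%:P - 'X).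
Proof.
have dY : (\det Y)%:P != 0 :> {poly F} by rewrite polyC_eq0 -unitfE -unitmxE.
apply: (mulIf dY); rewrite /char_pencil -det_map_mx -det_mulmx mulmxBl.
rewrite -scalemxAl -!map_mxM AY [map_mx _ (_ *m diag_mx _)]map_mxM map_diag_mx -mul_mx_scalar -mulmxBr.
have -> : diag_mx (map_mx polyC (\row_j l j)) - 'X%:M =
    diag_mx (\row_j ((l j)%:P - 'X)).
  apply/matrixP => i j; rewrite !mxE.
  by case: (i == j); rewrite ?mulr1n ?mulr0n ?subrr.
rewrite det_mulmx det_diag map_mxM det_mulmx !det_map_mx.
under eq_bigr => j _ do rewrite mxE.
by rewrite mulrAC.
Qed.

Lemma pencil_simple j : simple_gen_eigenvalue A B (l j).
Proof.
split; first by apply/pencil_eigenvalue; exists j.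
rewrite char_pencil_diag (bigD1 j) //= mulrA mulrAC mupMr.
  rewrite -opprB -scaleN1r -mul_polyC mupMr.
    by rewrite -['X - _]expr1 mup_XsubCX eqxx.
  by rewrite rootC oppr_eq0 oner_eq0.
rewrite rootM rootC negb_or -unitfE -unitmxE uB rootE horner_prod.
apply/prodf_neq0 => k kj.
by rewrite !hornerE subr_eq0 (inj_eq linj).
Qed.

End DiagonalisedPencil.

(** * The matrices of the eigenvalue problem *)

Lemma col_mulmx (F : pzRingType) m n p (A : 'M[F]_(m, n)) (B : 'M[F]_(n, p)) k :
  col k (A *m B) = A *m col k B.
Proof. by rewrite !colE mulmxA. Qed.

Section Matrices.
Context {R : realType} (zeta : R) (P : nat -> nat -> {poly R}).
Variable L : {poly R} -> R.
Hypothesis posL : pos_functional L.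
Let LD := functionalD posL.
Let LZ := functionalZ posL.
Let LB := functionalB posL.

(** The weight of superscript [l] relative to the one of superscript 0. *)
Definition weight_poly l : {poly R} := if l is 0 then 1 else 'X^2 - 1.

Hypothesis ip_juttner : forall l p q, (l <= 1)%N ->
  ip l zeta (horner p) (horner q) = L (weight_poly l * p * q).
Hypothesis onP : forall l, (l <= 1)%N -> orthonormal_family L (weight_poly l) (P l).

Let sP l k : (l <= 1)%N -> size (P l k) = k.+1.
Proof. by move=> l1; have [] := (onP l1).1 k. Qed.

Let lP l k : (l <= 1)%N -> 0 < lead_coef (P l k).
Proof. by move=> l1; have [] := (onP l1).1 k. Qed.

Let topP l k : (l <= 1)%N -> (P l k)`_k = lead_coef (P l k).
Proof. by move=> l1; rewrite /lead_coef sP. Qed.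

Let sXP l k : (l <= 1)%N -> size ('X * P l k) = k.+2.
Proof. by move=> l1; rewrite mulrC size_mulX ?sP // -size_poly_eq0 sP. Qed.

Lemma jacobiE l m (i j : 'I_m) : (l <= 1)%N ->
  jacobi zeta P l m i j = L (weight_poly l * P l i * ('X * P l j)).
Proof.
move=> l1; rewrite mxE.
have co k q := family_coef posL (onP l1) (n := k) (q := q).
have flip (a b : nat) : weight_poly l * P l a * ('X * P l b) = weight_poly l * P l b * ('X * P l a).
  by ring.
case: eqP => [ji|].
  rewrite /bcoef ip_juttner // ji; congr (L _); ring.
case: eqP => [ji _|].
  by rewrite flip co ?sXP ?ji // coefXM /= topP.
case: eqP => [ij _ _|n1 n2 n3].
  by rewrite co ?sXP ?ij // coefXM /= topP.
have [ij|ji] := ltnP i j.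
  have ij2 : (i.+2 <= j)%N by lia.
  by rewrite flip co ?sXP ?(leqW ij2) // nth_default ?mul0r // sXP.
have ji2 : (j.+2 <= i)%N by lia.
by rewrite co ?sXP ?(leqW ji2) // nth_default ?mul0r // sXP.
Qed.

Lemma jacobi_sym l m : (l <= 1)%N -> (jacobi zeta P l m)^T = jacobi zeta P l m.
Proof.
move=> l1; apply/matrixP => i j; rewrite mxE !jacobiE //; congr (L _); ring.
Qed.

Lemma sum_zerosE l k : (l <= 1)%N ->
  sum_zeros P l k = - ('X * P l k)`_k / lead_coef (P l k).
Proof.
move=> l1; have [sk lk ok _] := family_orthonormal_at posL (onP l1) k.
have Wp : pos_weight (weight_poly l).
  by case: (l); [exact: pos_weight1 | move=> ?; exact: pos_weight_X2].
rewrite /sum_zeros (ortho_sum_roots posL Wp sk ok).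
by rewrite coefXM; case: (k).
Qed.

(** The connection coefficients are mixed moments.  For the middle one the leading
term of [(X^2-1) P_k^(1)] is removed first; the next coefficient of each
polynomial is then its leading coefficient times minus the sum of its zeros. *)
Lemma jrectE m (k : 'I_m) (j : 'I_m.+1) :
  jrect P m k j = L (('X^2 - 1) * P 1 k * P 0 j).
Proof.
rewrite mxE.
have co0 i q := family_coef posL (onP (leq0n 1)) (n := i) (q := q).
have co1 i q := family_coef posL (onP (leqnn 1)) (n := i) (q := q).
have flip (a b : nat) : ('X^2 - 1) * P 1 a * P 0 b = weight_poly 0 * P 0 b * (('X^2 - 1) * P 1 a).
  by rewrite /weight_poly; ring.
have sW : (size ('X^2 - 1 : {poly R})%R <= 3)%N by rewrite size_XnsubC.
have W2 : ('X^2 - 1 : {poly R})`_2 = 1 by rewrite coefB coefXn coef1 subr0.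
have sWP a : (size (('X^2 - 1) * P 1 a)%R <= a.+3)%N.
  by apply: (size_mul_le sW); rewrite sP.
have topWP a : (('X^2 - 1) * P 1 a)`_a.+2 = lead_coef (P 1 a).
  by rewrite -[a.+2]/(2 + a)%N coefM_top ?sP // W2 mul1r topP.
case: eqP => [jk|nk].
  by rewrite jk co1 ?sP // topP.
case: eqP => [jk|nk1]; last first.
  case: eqP => [jk|nk2].
    by rewrite jk flip co0 // topWP.
  have [jk|kj] := ltnP j k.
    by rewrite co1 ?sP ?leqW // nth_default ?mul0r // sP.
  have kj3 : (k.+3 <= j)%N by lia.
  by rewrite flip co0 ?(leq_trans (sWP k)) ?leqW // nth_default ?mul0r // (leq_trans (sWP k)).
rewrite jk flip.
set r := lead_coef (P 1 k) / lead_coef (P 0 k.+2).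
have -> : ('X^2 - 1) * P 1 k = r *: P 0 k.+2 + (('X^2 - 1) * P 1 k - r *: P 0 k.+2).
  by rewrite addrCA subrr addr0.
rewrite mulrDr LD -scalerAr LZ (onP (leq0n 1)).2 ltn_eqF // mulr0 add0r.
rewrite co0; last first.
  apply: size_le_coef0.
    rewrite (leq_trans (size_polyD _ _)) // geq_max sWP size_polyN.
    by rewrite (leq_trans (size_scale_leq _ _)) // sP.
  by rewrite coefB topWP coefZ topP // divfK ?subrr // gt_eqF // lP.
have WPk : (('X^2 - 1) * P 1 k)`_k.+1 = ('X * P 1 k)`_k.
  rewrite mulrBl mul1r coefB [(P 1 k)`_k.+1]nth_default ?sP // subr0.
  by rewrite expr2 -mulrA [LHS]coefXM.
rewrite coefB coefZ WPk /qcoef !sum_zerosE // [('X * P 0 _)`__]coefXM /= /lc /r.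
have l0 := lP k.+2 (leq0n 1); have l0' := lP k.+1 (leq0n 1).
have l1 := lP k (leqnn 1).
field; by rewrite !gt_eqF.
Qed.

Definition poly_of (Q : nat -> {poly R}) m (u : 'cV[R]_m) : {poly R} :=
  \sum_(k < m) u k 0 *: Q k.

Lemma poly_of0 Q m : poly_of Q (0 : 'cV[R]_m) = 0.
Proof. by rewrite /poly_of big1 // => k _; rewrite mxE scale0r. Qed.

Lemma functional_poly_of Q m q (u : 'cV[R]_m) :
  L (q * poly_of Q u) = \sum_k u k 0 * L (q * Q k).
Proof.
rewrite mulr_sumr functional_sum //.
by apply: eq_bigr => k _; rewrite -scalerAr LZ.
Qed.

Lemma poly_of_linear Q m a (u v : 'cV[R]_m) :
  poly_of Q (a *: u + v) = a *: poly_of Q u + poly_of Q v.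
Proof.
rewrite /poly_of scaler_sumr -big_split; apply: eq_bigr => k _ /=.
by rewrite !mxE scalerDl scalerA.
Qed.

Lemma poly_ofZ Q m a (u : 'cV[R]_m) : poly_of Q (a *: u) = a *: poly_of Q u.
Proof. by rewrite -[a *: u]addr0 poly_of_linear poly_of0 addr0. Qed.

Lemma poly_ofD Q m (u v : 'cV[R]_m) : poly_of Q (u + v) = poly_of Q u + poly_of Q v.
Proof. by rewrite -[u]scale1r poly_of_linear !scale1r. Qed.

Lemma poly_ofB Q m (u v : 'cV[R]_m) : poly_of Q (u - v) = poly_of Q u - poly_of Q v.
Proof. by rewrite poly_ofD -scaleN1r poly_ofZ scaleN1r. Qed.

Lemma poly_of_Pvec l m x : poly_of (P l) (Pvec P l m x) = kernel (P l) m x.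
Proof. by apply: eq_bigr => k _; rewrite mxE. Qed.

Lemma poly_of_eq0 l m (u : 'cV[R]_m) : (l <= 1)%N -> poly_of (P l) u = 0 -> u = 0.
Proof.
move=> l1 u0; apply/matrixP => i j; rewrite (ord1 j) [RHS]mxE.
have : L (weight_poly l * P l i * poly_of (P l) u) = 0.
  by rewrite u0 mulr0 functional0.
rewrite mulr_sumr functional_sum // (bigD1 i) //= big1 => [|k ki].
  by rewrite addr0 -scalerAr LZ (onP l1).2 eqxx mulr1.
by rewrite -scalerAr LZ (onP l1).2 val_eqE eq_sym (negbTE ki) mulr0.
Qed.

Variable n : nat.

Lemma A0_mul (u : 'cV[R]_n.+1) (v : 'cV[R]_n) :
  A0 zeta P n *m col_mx u v =
  col_mx (\col_k L ('X * poly_of (P 0) u * P 0 k))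
         (\col_k L ('X * ('X^2 - 1) * poly_of (P 1) v * P 1 k)).
Proof.
rewrite /A0 mul_block_col !mul0mx addr0 add0r; congr col_mx;
  apply/matrixP => i j; rewrite (ord1 j) !mxE mulr_sumr mulr_suml functional_sum //;
  apply: eq_bigr => k _; rewrite jacobiE // mulrC -LZ /weight_poly; congr (L _);
  by rewrite -!mul_polyC; ring.
Qed.

Lemma A1_mul (u : 'cV[R]_n.+1) (v : 'cV[R]_n) :
  A1 P n *m col_mx u v =
  col_mx (\col_k L (('X^2 - 1) * poly_of (P 1) v * P 0 k))
         (\col_k L (('X^2 - 1) * poly_of (P 0) u * P 1 k)).
Proof.
rewrite /A1 mul_block_col !mul0mx addr0 add0r; congr col_mx;
  apply/matrixP => i j; rewrite (ord1 j) !mxE mulr_sumr mulr_suml functional_sum //;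
  apply: eq_bigr => k _; rewrite ?[(jrect _ _)^T _ _]mxE jrectE mulrC -LZ; congr (L _);
  by rewrite -!mul_polyC; ring.
Qed.

Lemma A0_sym : (A0 zeta P n)^T = A0 zeta P n.
Proof. by rewrite tr_block_mx !trmx0 !jacobi_sym. Qed.

Lemma A1_sym : (A1 P n)^T = A1 P n.
Proof. by rewrite tr_block_mx !trmx0 trmxK. Qed.

Lemma eigen_pair_mx lam (u : 'cV[R]_n.+1) (v : 'cV[R]_n) :
  eigen_pair L n lam (poly_of (P 0) u) (poly_of (P 1) v) ->
  A1 P n *m col_mx u v = lam *: (A0 zeta P n *m col_mx u v).
Proof.
move=> [e1 e2]; rewrite A1_mul A0_mul scale_col_mx; congr col_mx;
  apply/matrixP => i j; rewrite !mxE.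
  by rewrite e1 // sP // ltnS -ltnS.
by rewrite e2 // sP.
Qed.

Lemma A0_quad (u : 'cV[R]_n.+1) (v : 'cV[R]_n) :
  ((col_mx u v)^T *m (A0 zeta P n *m col_mx u v)) 0 0 =
  L ('X * (poly_of (P 0) u * poly_of (P 0) u +
     ('X^2 - 1) * (poly_of (P 1) v * poly_of (P 1) v))).
Proof.
rewrite A0_mul tr_col_mx mul_row_col !mxE.
set f := poly_of _ u; set g := poly_of _ v.
have -> : 'X * (f * f + ('X^2 - 1) * (g * g)) =
   'X * f * f + 'X * ('X^2 - 1) * g * g by ring.
rewrite LD !functional_poly_of.
by congr (_ + _); apply: eq_bigr => k _; rewrite !mxE.
Qed.

Lemma A0_posdef (y : 'cV[R]_(n.+1 + n)) : y != 0 ->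
  0 < (y^T *m (A0 zeta P n *m y)) 0 0.
Proof.
move=> y0; rewrite -(vsubmxK y) A0_quad; apply: eigen_pair_norm_gt0 => //.
apply: contraNT y0; rewrite negb_or !negbK => /andP[/eqP u0 /eqP v0].
by rewrite -(vsubmxK y) (poly_of_eq0 _ u0) // (poly_of_eq0 _ v0) // col_mx0.
Qed.

Let on0 : orthonormal_family L 1 (P 0). Proof. exact: (onP (leq0n 1)). Qed.
Let on1 : orthonormal_family L ('X^2 - 1) (P 1). Proof. exact: (onP (leqnn 1)). Qed.
Let on0S := family_orthonormal_at posL on0 n.+1.
Let on1n := family_orthonormal_at posL on1 n.

Definition lamQ (i : int) : R := Num.sqrt (zQ P n i ^+ 2 - 1) / zQ P n i.

Lemma zQ0 : zQ P n 0 = 0.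
Proof. by rewrite /zQ sgz0 mul0r. Qed.

Lemma lamQ0 : lamQ 0 = 0.
Proof. by rewrite /lamQ zQ0 invr0 mulr0. Qed.

Let QE : Qpoly P n = Qpair (P 0 n.+1) (P 1 n). Proof. by []. Qed.

Lemma nth_zeros_gt1 k : (k < n)%N ->
  1 < nth 0 (zeros_gt1 (Qpoly P n)) k /\ root (Qpoly P n) (nth 0 (zeros_gt1 (Qpoly P n)) k).
Proof.
move=> kn; apply/andP; rewrite -mem_zeros_gt1 ?mem_nth //.
  by rewrite QE (size_zeros_gt1 posL on0S on1n).
by rewrite QE (Qpair_neq0 posL on0S on1n).
Qed.

Lemma zQE (i : int) : zQ P n i = (sgz i)%:~R * nth 0 (zeros_gt1 (Qpoly P n)) `|i|%N.-1.
Proof. by []. Qed.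

Lemma zQ_oppr i : zQ P n (- i) = - zQ P n i.
Proof. by rewrite !zQE sgzN abszN rmorphN mulNr. Qed.

Lemma lamQ_oppr i : lamQ (- i) = - lamQ i.
Proof. by rewrite /lamQ zQ_oppr sqrrN invrN mulrN. Qed.

Lemma zQ_root_gt1 i : 0 < i -> (`|i| <= n)%N ->
  1 < zQ P n i /\ root (Qpoly P n) (zQ P n i).
Proof.
move=> i0 ni; rewrite zQE gtr0_sgz // mul1r; apply: nth_zeros_gt1.
by move: i0 ni; case: i => [[|k]|k].
Qed.

Lemma Qpair_even (p q : {poly R}) (x : R) : root (Qpair p q) (- x) = root (Qpair p q) x :> bool.
Proof.
by rewrite !rootE !Qpair_horner opprK addrC.
Qed.

Lemma zQ_root i : i != 0 -> (`|i| <= n)%N ->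
  [/\ 1 < zQ P n i ^+ 2, root (Qpoly P n) (zQ P n i) & (0 < zQ P n i) = (0 < i)].
Proof.
rewrite neq_lt => /orP[i0|i0] ni; last first.
  have [z1 rz] := zQ_root_gt1 i0 ni; rewrite exprn_egt1 // rz i0.
  by split=> //; apply: lt_trans z1.
have ni' : (`|- i| <= n)%N by rewrite abszN.
have [|z1 rz] := zQ_root_gt1 _ ni'; first by rewrite oppr_gt0.
rewrite -(opprK i) zQ_oppr sqrrN exprn_egt1 // QE Qpair_even -QE rz.
split=> //; rewrite oppr_gt0 opprK ltNge ltW ?(lt_trans _ z1) //=.
by rewrite ltNge ltW.
Qed.

Lemma lamQ_gt0 i : 0 < i -> (`|i| <= n)%N -> 0 < lamQ i < 1.
Proof.
move=> i0 ni; have [z1 _] := zQ_root_gt1 i0 ni.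
have z0 : 0 < zQ P n i by apply: lt_trans z1.
rewrite divr_gt0 //=; last by rewrite sqrtr_gt0 subr_gt0 exprn_egt1.
rewrite ltr_pdivrMr // mul1r -(ltr_pXn2r (_ : 0 < 2)%N) ?nnegrE ?sqrtr_ge0 ?(ltW z0) //.
by rewrite sqr_sqrtr ?subr_ge0 ?ltW ?exprn_egt1 // gtrBl.
Qed.

Lemma lamQ_norm_lt1 i : (`|i| <= n)%N -> `|lamQ i| < 1.
Proof.
move=> ni; case: (ltrgtP 0 i) => [i0|i0|<-]; last by rewrite lamQ0 normr0.
  by have /andP[l0 l1] := lamQ_gt0 i0 ni; rewrite gtr0_norm.
have /andP[l0 l1] : 0 < lamQ (- i) < 1 by apply: lamQ_gt0; rewrite ?oppr_gt0 ?abszN.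
by rewrite -normrN -lamQ_oppr gtr0_norm.
Qed.

Lemma lamQ_sqr i : i != 0 -> (`|i| <= n)%N -> lamQ i ^+ 2 = 1 - (zQ P n i ^+ 2)^-1.
Proof.
move=> i0 ni; have [z1 _ _] := zQ_root i0 ni.
rewrite expr_div_n sqr_sqrtr ?subr_ge0 1?ltW // mulrBl mul1r divff //.
by rewrite gt_eqF // (lt_trans ltr01).
Qed.

Lemma lamQ_pos i : (`|i| <= n)%N -> (0 < lamQ i) = (0 < i).
Proof.
move=> ni; case: (ltrgtP 0 i) => [i0|i0|<-].
- by have /andP[] := lamQ_gt0 i0 ni.
- have : 0 < lamQ (- i).
    by have /andP[] : 0 < lamQ (- i) < 1 by apply: lamQ_gt0; rewrite ?oppr_gt0 ?abszN.
  by rewrite lamQ_oppr oppr_gt0 => H; apply/negbTE; rewrite -leNgt ltW.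
- by rewrite lamQ0 ltxx.
Qed.

Lemma lamQ_neq0 i : (`|i| <= n)%N -> i != 0 -> lamQ i != 0.
Proof.
move=> ni; rewrite neq_lt => /orP[i0|i0].
  have : 0 < lamQ (- i) by rewrite lamQ_pos ?abszN // oppr_gt0.
  by rewrite lamQ_oppr oppr_gt0 => /lt_eqF ->.
by rewrite gt_eqF // lamQ_pos.
Qed.

Lemma lamQ_inj_pos i j : 0 < i -> 0 < j -> (`|i| <= n)%N -> (`|j| <= n)%N ->
  lamQ i = lamQ j -> i = j.
Proof.
move=> i0 j0 ni nj /(congr1 (fun x => x ^+ 2)).
rewrite !lamQ_sqr // ?gt_eqF // => /addrI/oppr_inj/invr_inj/eqP.
have [zi _] := zQ_root_gt1 i0 ni; have [zj _] := zQ_root_gt1 j0 nj.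
rewrite eqrXn2 ?ltW ?(lt_trans ltr01) //.
rewrite !zQE !gtr0_sgz // !mul1r.
rewrite nth_uniq ?QE ?(size_zeros_gt1 posL on0S on1n) ?filter_uniq ?uniq_roots //.
- by move: i0 j0; case: i {ni zi} => [[|a]|a] //; case: j {nj zj} => [[|b]|b] // _ _ /= /eqP ->.
- by move: i0 ni; case: i {zi} => [[|a]|a].
- by move: j0 nj; case: j {zj} => [[|a]|a].
Qed.

Lemma lamQ_inj i j : (`|i| <= n)%N -> (`|j| <= n)%N -> lamQ i = lamQ j -> i = j.
Proof.
move=> ni nj lij; have pij : (0 < i) = (0 < j) by rewrite -!lamQ_pos // lij.
have nij : (0 < - i) = (0 < - j) by rewrite -!lamQ_pos ?abszN // !lamQ_oppr lij.
case: (ltrgtP 0 i) pij nij => [i0|i0|<-]; last 1 first.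
- move=> /esym j1 /esym; rewrite oppr0 ltxx oppr_gt0 => j2; apply/eqP.
  by rewrite eq_le leNgt j2 leNgt j1.
- by move=> /esym j0 _; apply: lamQ_inj_pos.
move=> _; rewrite !oppr_gt0 i0 => /esym j0; apply: oppr_inj.
by apply: lamQ_inj_pos; rewrite ?abszN ?oppr_gt0 // !lamQ_oppr lij.
Qed.

Lemma poly_of_uvec i : i != 0 ->
  poly_of (P 0) (uvec P n i) = eigen_f (P 0) (P 1) n (zQ P n i).
Proof.
by move=> /negbTE i0; rewrite /uvec i0 poly_ofD !poly_ofZ !poly_of_Pvec.
Qed.

Lemma poly_of_vvec i : i != 0 ->
  poly_of (P 1) (vvec P n i) = eigen_g (P 1) n (zQ P n i).
Proof.
by move=> /negbTE i0; rewrite /vvec i0 poly_ofZ poly_ofB !poly_ofZ !poly_of_Pvec.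
Qed.

Lemma yvec_eigen i : (`|i| <= n)%N ->
  A1 P n *m yvec P n i = lamQ i *: (A0 zeta P n *m yvec P n i).
Proof.
move=> ni; apply: eigen_pair_mx; have [->|i0] := eqVneq i 0.
  rewrite lamQ0 /uvec /vvec eqxx poly_of0 poly_ofB !poly_ofZ !poly_of_Pvec.
  exact: (eigen_pair0 posL n on0).
rewrite poly_of_uvec // poly_of_vvec //.
have [z1 rz _] := zQ_root i0 ni.
exact: eigen_pair_kernel.
Qed.

(** As [P_0] is constant, the first entries of [u] and [v] for
[i != 0] vanish together only if [P_n^(1)] vanishes at [z] and [-z], one of
which is left of 1.  For [i = 0] two entries of [u] are needed. *)
Lemma yvec_neq0 i : (0 < n)%N -> (`|i| <= n)%N -> yvec P n i != 0.
Proof.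
move=> n0 ni; apply/negP => /eqP y0.
have : uvec P n i = 0 /\ vvec P n i = 0.
  by have /eq_col_mx : col_mx (uvec P n i) (vvec P n i) = col_mx 0 0 by rewrite col_mx0.
move=> [u0 v0].
have c0 l x : (l <= 1)%N -> (P l 0).[x] = lead_coef (P l 0).
  move=> l1; rewrite (size1_polyC (_ : size (P l 0) <= 1)%N) ?sP //.
  by rewrite hornerC lead_coefC.
have := congr1 (fun u : 'cV[R]_n.+1 => u 0 0) u0.
have [i0|i0] := eqVneq i 0.
  rewrite /uvec i0 eqxx !mxE !c0 // -mulrBl => /eqP.
  rewrite mulf_eq0 [_ (P 0 0) == 0]gt_eqF ?lP // orbF subr_eq0 => /eqP E.
  have := congr1 (fun u : 'cV[R]_n.+1 => u (inord 1) 0) u0.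
  rewrite /uvec i0 eqxx !mxE inordK // E -mulrBr => /eqP.
  have [_ _ o0n _] := on0S.
  rewrite mulf_eq0 (negbTE (ortho_horner_neq0 posL pos_weight1 (sP n.+1 (leq0n 1)) o0n (lexx 1))) /=.
  rewrite subr_eq0 => /eqP; have [a [b [a0 ->]]] : exists a b, a != 0 /\ P 0 1 = a *: 'X + b%:P.
    exists (lead_coef (P 0 1)), (P 0 1)`_0; split; first by rewrite gt_eqF ?lP.
    apply/polyP => -[|[|k]]; rewrite coefD coefZ coefX coefC /= ?mulr0 ?add0r ?mulr1 ?addr0 ?topP //.
    by rewrite nth_default // sP.
  by rewrite !hornerE => aE; case/eqP: a0; lra.
rewrite /uvec (negbTE i0) !mxE !c0 // -mulrDl => /eqP.
rewrite mulf_eq0 [_ (P 0 0) == 0]gt_eqF ?lP // orbF => /eqP E1.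
have := congr1 (fun v : 'cV[R]_n => v (Ordinal n0) 0) v0.
have [z1 rz _] := zQ_root i0 ni.
rewrite /vvec (negbTE i0) !mxE /= !c0 // -mulrBl => /eqP.
rewrite !mulf_eq0 [_ (P 1 0) == 0]gt_eqF ?lP // orbF sqrtr_eq0 subr_le0 leNgt z1 /= => /eqP E2.
have [_ _ o1n _] := on1n.
have nz := ortho_horner_neq0 posL pos_weight_X2 (sP n (leqnn 1)) o1n.
have : (P 1 n).[zQ P n i] = 0 /\ (P 1 n).[- zQ P n i] = 0 by split; lra.
case=> h1 h2; case: (lerP (zQ P n i) 0) => z0.
  by have := nz _ (le_trans z0 ler01); rewrite h1 eqxx.
have z0' : - zQ P n i <= 1 by lra.
by have := nz _ z0'; rewrite h2 eqxx.
Qed.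

Definition signed_index (k : 'I_(n.+1 + n)) : int := (k : nat)%:Z - n%:Z.

Lemma signed_index_le k : (`|signed_index k| <= n)%N.
Proof. by rewrite /signed_index; have := ltn_ord k; lia. Qed.

Lemma signed_index_inj : injective signed_index.
Proof. by move=> k k' /addIr [] /val_inj. Qed.

Lemma signed_index_surj i : (`|i| <= n)%N -> exists k, signed_index k = i.
Proof.
move=> ni; have ltk : (`|(i + n%:Z)%R| < n.+1 + n)%N by lia.
by exists (Ordinal ltk); rewrite /signed_index /=; lia.
Qed.

Hypothesis n_gt0 : (0 < n)%N.

Definition eigenmx : 'M[R]_(n.+1 + n) := \matrix_(i, k) yvec P n (signed_index k) i 0.

Lemma col_eigenmx k : col k eigenmx = yvec P n (signed_index k).
Proof. by apply/matrixP => i j; rewrite (ord1 j) !mxE. Qed.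

Lemma eigenmx_eigen : A1 P n *m eigenmx = A0 zeta P n *m eigenmx *m diag_mx (\row_k lamQ (signed_index k)).
Proof.
apply/matrixP => i k; rewrite mul_mx_diag mxE.
have := congr1 (fun w : 'cV_(_) => w i 0) (yvec_eigen (signed_index_le k)).
rewrite -col_eigenmx -!col_mulmx !mxE => ->; rewrite mulrC.
congr (_ * _); rewrite ?mxE //.
Qed.

(** Eigenvectors of a symmetric pencil for distinct eigenvalues are orthogonal for [A0], so
their Gram matrix is diagonal with positive entries.  Its invertibility gives that of
[A0] and of the matrix of eigenvectors at once. *)
Lemma gram_unit : eigenmx^T *m A0 zeta P n *m eigenmx \in unitmx.
Proof.
have -> : eigenmx^T *m A0 zeta P n *m eigenmx =
    diag_mx (\row_k ((yvec P n (signed_index k))^T *m (A0 zeta P n *m yvec P n (signed_index k))) 0 0).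
  have entry j k : (eigenmx^T *m A0 zeta P n *m eigenmx) j k =
      ((yvec P n (signed_index j))^T *m (A0 zeta P n *m yvec P n (signed_index k))) 0 0.
    by rewrite -!col_eigenmx -mulmxA tr_col -col_mulmx -row_mul !mxE; apply: eq_bigr => i _; rewrite !mxE.
  apply/matrixP => j k; rewrite entry [RHS]mxE [X in X *+ _]mxE.
  case: eqVneq => [->|jk]; rewrite ?mulr1n ?mulr0n //.
  set yj := yvec P n (signed_index j); set yk := yvec P n (signed_index k).
  have : (lamQ (signed_index j) - lamQ (signed_index k)) * (yj^T *m (A0 zeta P n *m yk)) 0 0 = 0.
    have E : yj^T *m (A1 P n *m yk) = (A1 P n *m yj)^T *m yk.
      by rewrite trmx_mul A1_sym mulmxA.
    move: E; rewrite !yvec_eigen ?signed_index_le // [(_ *: _)^T]linearZ /=.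
    rewrite trmx_mul A0_sym -scalemxAl -scalemxAr mulmxA.
    move=> /matrixP/(_ 0 0); rewrite !mxE mulrBl => <-; rewrite subrr //.
  move/eqP; rewrite mulf_eq0 subr_eq0 => /orP[/eqP/lamQ_inj|/eqP //].
  by move=> /(_ (signed_index_le _) (signed_index_le _))/signed_index_inj/eqP; rewrite (negbTE jk).
rewrite unitmxE det_diag unitfE; apply/prodf_neq0 => k _.
by rewrite mxE gt_eqF // A0_posdef // yvec_neq0 // signed_index_le.
Qed.

Lemma A0_unit : A0 zeta P n \in unitmx.
Proof. by have := gram_unit; rewrite !unitmx_mul => /andP[/andP[]]. Qed.

Lemma eigenmx_unit : eigenmx \in unitmx.
Proof. by have := gram_unit; rewrite !unitmx_mul => /andP[]. Qed.

Lemma complex_mxE m1 m2 (M : 'M[R]_(m1, m2)) : complex_mx M = map_mx (real_complex R) M.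
Proof. by []. Qed.

Let lamC (k : 'I_(n.+1 + n)) : R[i] := ((lamQ (signed_index k))%:C)%C.

Lemma lamC_inj : injective lamC.
Proof.
by move=> j k /complexI E; apply/signed_index_inj/lamQ_inj; rewrite ?signed_index_le.
Qed.

Lemma complex_eigen : complex_mx (A1 P n) *m complex_mx eigenmx =
  complex_mx (A0 zeta P n) *m complex_mx eigenmx *m diag_mx (\row_k lamC k).
Proof.
rewrite !complex_mxE -!map_mxM eigenmx_eigen [LHS]map_mxM map_diag_mx; congr (_ *m diag_mx _).
by apply/matrixP => i k; rewrite !mxE.
Qed.

Lemma spectral_facts :
  [/\ forall mu : R[i], gen_eigenvalue (complex_mx (A1 P n)) (complex_mx (A0 zeta P n)) mu <->
        exists2 i : int, (`|i| <= n)%N & mu = ((lamQ i)%:C)%C,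
      forall i, (`|i| <= n)%N -> simple_gen_eigenvalue (complex_mx (A1 P n))
        (complex_mx (A0 zeta P n)) ((lamQ i)%:C)%C
    & forall i, (`|i| <= n)%N -> forall w : 'cV[R[i]]_(n.+1 + n),
        complex_mx (A1 P n) *m w = ((lamQ i)%:C)%C *: (complex_mx (A0 zeta P n) *m w) <->
        exists c : R[i], w = c *: complex_mx (yvec P n i)].
Proof.
have uB : complex_mx (A0 zeta P n) \in unitmx by rewrite complex_mxE map_unitmx A0_unit.
have uY : complex_mx eigenmx \in unitmx by rewrite complex_mxE map_unitmx eigenmx_unit.
split=> [mu|i /signed_index_surj[k <-]|i /signed_index_surj[k <-] w].
- rewrite (pencil_eigenvalue uB uY lamC_inj complex_eigen); split=> [[k ->]|[i ni ->]].
    by exists (signed_index k) => //; apply: signed_index_le.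
  by have [k <-] := signed_index_surj ni; exists k.
- exact: (pencil_simple uB uY lamC_inj complex_eigen).
- rewrite (pencil_eigenspace uB uY lamC_inj complex_eigen) complex_mxE -map_col col_eigenmx.
  by [].
Qed.

End Matrices.

(** * Differentiating Laplace integrals *)

Section LaplaceMoments.
Local Open Scope classical_set_scope.
Local Open Scope ring_scope.
Context {R : realType} (D : set R) (mD : measurable D) (phi w : R -> R).
Hypotheses (mphi : measurable_fun setT phi) (mw : measurable_fun setT w).
Hypotheses (phi0 : forall x, D x -> 0 <= phi x) (w0 : forall x, D x -> 0 <= w x).
Local Notation mu := (@lebesgue_measure R).

(** Both [K1] and the moments of the weight are of this form, with [phi] equal to [cosh]
and to the identity. *)
Definition laplace_density k t x : R := phi x ^+ k * w x * expR (- t * phi x).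

Definition laplace_moment k t : R := Rintegral mu D (laplace_density k t).

Hypothesis base : forall t, 0 < t -> mu.-integrable D (EFin \o laplace_density 0 t).

Lemma expr_le_expR k (x : R) : 0 <= x -> x ^+ k <= k`!%:R * expR x.
Proof.
move=> x0; case: k => [|k]; first by rewrite expr0 fact0 mul1r -expR0 ler_expR.
have := expR_ge1Dxn k x0; rewrite -ler_pdivrMl ?ltr0n ?fact_gt0 // mulrC.
by apply: le_trans; rewrite lerDr.
Qed.

(** Powers are absorbed by half of the exponential decay. *)
Lemma expr_mul_expR_le k (t y : R) : 0 < t -> 0 <= y ->
  y ^+ k * expR (- t * y) <= k`!%:R / (t / 2) ^+ k * expR (- (t / 2) * y).
Proof.
move=> t0 y0; have t2 : 0 < t / 2 by rewrite divr_gt0.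
have -> : - t * y = - (t / 2) * y + - (t / 2) * y by rewrite -mulrDl; congr (_ * _); lra.
rewrite expRD mulrA ler_wpM2r ?expR_ge0 //.
rewrite -ler_pdivlMr ?expR_gt0 // mulNr expRN invrK mulrAC.
rewrite ler_pdivlMr ?exprn_gt0 // -exprMn [y * _]mulrC.
by rewrite expr_le_expR // mulr_ge0 // ltW.
Qed.

Lemma measurable_laplace_density k t : measurable_fun setT (laplace_density k t).
Proof.
apply: measurable_funM; first by apply: measurable_funM => //; exact: measurable_funX.
apply: measurableT_comp => //; exact: measurable_funM.
Qed.

Lemma laplace_density_ge0 k t x : D x -> 0 <= laplace_density k t x.
Proof.
by move=> Dx; rewrite !mulr_ge0 ?expR_ge0 ?exprn_ge0 ?phi0 ?w0.
Qed.

Lemma laplace_integrable k t : 0 < t -> mu.-integrable D (EFin \o laplace_density k t).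
Proof.
move=> t0; have t2 : 0 < t / 2 by rewrite divr_gt0.
pose C : R := k`!%:R / (t / 2) ^+ k.
pose G x := (C%:E * (EFin \o laplace_density 0 (t / 2)) x)%E.
have iG : mu.-integrable D G by exact/integrableZl/base.
have := @le_integrable _ _ R mu D mD (EFin \o laplace_density k t) G.
apply => //.
- by apply/measurable_EFinP; apply: measurable_funTS; exact: measurable_laplace_density.
- move=> x Dx; rewrite /= lee_fin ger0_norm ?laplace_density_ge0 //.
  rewrite ger0_norm; last by rewrite mulr_ge0 ?laplace_density_ge0 // divr_ge0 // exprn_ge0 // ltW.
  rewrite /laplace_density expr0 mul1r mulrAC mulrCA [w x * _]mulrC ler_wpM2r ?w0 //.
  exact: expr_mul_expR_le (phi0 Dx).
Qed.

(** Near [t] the derivatives are dominated by their values at [t/2]. *)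
Lemma laplace_moment_derive k t : 0 < t ->
  h^-1 *: (laplace_moment k (h + t) - laplace_moment k t) @[h --> 0^'] -->
    - laplace_moment k.+1 t.
Proof.
move=> t0; have t2 : 0 < t / 2 by rewrite divr_gt0.
have d1 (x y : R) : is_derive x 1 (fun s => laplace_density k s y) (- laplace_density k.+1 x y).
  apply: is_derive_eq.
  rewrite /laplace_density exprS /GRing.scale /= !mulr0; ring.
have dE (x y : R) : partial1of2 (laplace_density k) x y = - laplace_density k.+1 x y.
  by rewrite /partial1of2 derive1E; apply: derive_val.
have ineq x : `](t / 2), (2 * t)[%classic x -> t / 2 < x.
  by rewrite /= in_itv /= => /andP[].
have It : `](t / 2), (2 * t)[%classic t by rewrite /= in_itv /=; apply/andP; split; lra.
have Ix x : `](t / 2), (2 * t)[%classic x -> mu.-integrable D (EFin \o laplace_density k x).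
  by move=> /ineq tx; apply: laplace_integrable; apply: lt_trans tx.
have dx (x y : R) : `](t / 2), (2 * t)[%classic x -> D y ->
  derivable (fun s => laplace_density k s y) x 1 by [].
have iG : mu.-integrable D (EFin \o (fun y => `|laplace_density k.+1 (t / 2) y|)).
  exact: (integrable_norm (laplace_integrable k.+1 t2)).
have ub (x y : R) : `](t / 2), (2 * t)[%classic x -> D y ->
    `|partial1of2 (laplace_density k) x y| <= `|laplace_density k.+1 (t / 2) y|.
  move=> /ineq /ltW tx Dy; rewrite dE normrN !ger0_norm ?laplace_density_ge0 //.
  rewrite ler_wpM2l ?mulr_ge0 ?exprn_ge0 ?phi0 ?w0 // ler_expR.
  by rewrite ler_wpM2r ?phi0 // lerN2.
have := @cvg_differentiation_under_integral R _ _ mu (laplace_density k) D mD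
  t (t / 2) (2 * t) It Ix dx (fun y => `|laplace_density k.+1 (t / 2) y|)
  (fun y => normr_ge0 _) iG ub.
suff -> : Rintegral mu D (partial1of2 (laplace_density k) t) = - laplace_moment k.+1 t by [].
rewrite /laplace_moment -mulN1r -RintegralZl //; last exact: laplace_integrable.
by apply: eq_Rintegral => y _; apply: etrans (dE _ _) (esym (mulN1r _)).
Qed.

End LaplaceMoments.

(** * The functional attached to the weight *)

Section IntegralTools.
Local Open Scope classical_set_scope.
Local Open Scope ring_scope.
Context {R : realType}.
Local Notation mu := (@lebesgue_measure R).

(** The real value of an infinite integral is 0. *)
Lemma Rintegral_neq0_integrable (D : set R) (f : R -> R) : measurable D ->
  measurable_fun setT f -> (forall x, D x -> 0 <= f x) ->
  Rintegral mu D f != 0 -> mu.-integrable D (EFin \o f).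
Proof.
move=> mD mf f0 If; apply/integrableP; split.
  by apply/measurable_EFinP; apply: measurable_funTS.
have -> : (\int[mu]_(x in D) `|(EFin \o f) x| = \int[mu]_(x in D) (EFin \o f) x)%E.
  by apply: eq_integral => x /set_mem Dx /=; rewrite ger0_norm ?f0.
have I0 : (0 <= \int[mu]_(x in D) (EFin \o f) x)%E.
  by apply: integral_ge0 => x Dx; rewrite /= lee_fin f0.
rewrite ltey; apply: contraNneq If => If.
by rewrite /Rintegral [X in fine X]If.
Qed.

Lemma cvg_quotient_derivable (f : R -> R) (t d : R) :
  h^-1 *: (f (h + t) - f t) @[h --> 0^'] --> d -> derivable f t 1 /\ f^`()%classic t = d.
Proof.
move=> fd; have : h^-1 *: (f (h *: (1 : R) + t) - f t) @[h --> 0^'] --> d.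
  by under eq_fun => h do rewrite [h *: _]mulr1.
move=> fd'; split; first by apply/cvg_ex; exists d.
by rewrite derive1E; apply: cvg_lim fd'.
Qed.

Lemma cvg_quotient_continuous (f : R -> R) (t d : R) :
  h^-1 *: (f (h + t) - f t) @[h --> 0^'] --> d -> {for t, continuous f}.
Proof.
by move=> /cvg_quotient_derivable[/derivable1_diffP/differentiable_continuous].
Qed.

End IntegralTools.

Section Moments.
Local Open Scope classical_set_scope.
Local Open Scope ring_scope.
Context {R : realType}.
Implicit Types (m : nat -> R) (p q : {poly R}).

(** Linear for any sequence [m], even when it is not a sequence of moments. *)
Definition moment_functional m p : R := \sum_(k < size p) p`_k * m k.

Lemma moment_functional_wide m p S : (size p <= S)%N ->
  moment_functional m p = \sum_(k < S) p`_k * m k.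
Proof.
move=> pS; rewrite /moment_functional (big_ord_widen _ (fun k => p`_k * m k) pS).
rewrite big_mkcond; apply: eq_bigr => k _; case: ltnP => // pk.
by rewrite nth_default ?mul0r.
Qed.

Lemma moment_functionalD m p q :
  moment_functional m (p + q) = moment_functional m p + moment_functional m q.
Proof.
pose S := maxn (size p) (size q).
rewrite !(@moment_functional_wide _ _ S) ?leq_maxl ?leq_maxr ?size_polyD //.
by rewrite -big_split; apply: eq_bigr => k _; rewrite coefD mulrDl.
Qed.

Lemma moment_functionalZ m c p :
  moment_functional m (c *: p) = c * moment_functional m p.
Proof.
rewrite !(@moment_functional_wide _ _ (size p)) ?size_scale_leq // mulr_sumr.
by apply: eq_bigr => k _; rewrite coefZ mulrA.
Qed.

Lemma moment_functionalX m p :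
  moment_functional m ('X * p) = moment_functional (fun k => m k.+1) p.
Proof.
have [->|p0] := eqVneq p 0.
  by rewrite mulr0 /moment_functional size_poly0 !big_ord0.
rewrite /moment_functional mulrC size_mulX // big_ord_recl coefMX mul0r add0r.
by apply: eq_bigr => k _; rewrite coefMX.
Qed.

End Moments.

Section JuttnerWeight.
Local Open Scope classical_set_scope.
Local Open Scope ring_scope.
Context {R : realType}.
Local Notation mu := (@lebesgue_measure R).
Local Notation D1 := (`[1, +oo[%classic : set R).

Definition chebyshev_weight (x : R) : R := (x ^+ 2 - 1) `^ (0%:R - 2^-1).

Local Notation dens := (laplace_density id chebyshev_weight).

Definition moment (t : R) k : R := laplace_moment D1 id chebyshev_weight k t.

Lemma measurable_chebyshev_weight : measurable_fun setT chebyshev_weight.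
Proof.
apply: (measurableT_comp (measurable_powR _)).
by apply: measurable_funD => //; exact: measurable_funX.
Qed.

Lemma chebyshev_weight_ge0 x : 0 <= chebyshev_weight x.
Proof. exact: powR_ge0. Qed.

Lemma half_line_ge0 (x : R) : D1 x -> 0 <= x.
Proof. by rewrite /= in_itv /= andbT; apply: le_trans. Qed.

Lemma density_ge0 k t x : D1 x -> 0 <= dens k t x.
Proof.
by apply: laplace_density_ge0 => y // Dy; [exact: half_line_ge0 | exact: chebyshev_weight_ge0].
Qed.

Lemma measurable_half_line : measurable (D1 : set (measurableTypeR R)). Proof. exact: measurable_itv. Qed.

Variable P : R -> nat -> nat -> {poly R}.
Hypothesis hP : forall (zeta : R) (l : nat), 0 < zeta -> (l <= 1)%N ->
          orthonormal_polys l zeta (P zeta l).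

(** Were [K1] zero, the weight and all inner products would vanish. *)
Lemma K1_gt0 (t : R) : 0 < t -> 0 < K1 t.
Proof.
move=> t0; rewrite lt_def Rintegral_ge0 ?andbT; last first.
  move=> x _; rewrite mulr_ge0 ?expR_ge0 // divr_ge0 // addr_ge0 ?expR_ge0 //.
have [_ /(_ 0 0)%N /eqP] := hP t0 (leq0n 1).
apply: contraTneq => K10; rewrite /ip eq_sym /Rintegral integral0_eq ?oner_eq0 //.
by move=> x _; rewrite /omega K10 invr0 !mul0r mulr0.
Qed.

(** The inner product of the constant [P_0] with itself is 1, hence its integrand is
integrable. *)
Lemma density0_integrable (t : R) : 0 < t -> mu.-integrable D1 (EFin \o dens 0 t).
Proof.
move=> t0; have [P0 Pon] := hP t0 (leq0n 1).
have [s0 l0] := P0 0%N; have p0E := size1_polyC (_ : size (P t 0 0) <= 1)%N.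
set c := (P t 0 0)`_0 in p0E.
have {}p0E : P t 0 0 = c%:P by rewrite p0E ?s0.
have c0 : c != 0 by apply: contraTneq l0 => c0; rewrite p0E c0 lead_coef0 ltxx.
have K0 := K1_gt0 t0.
pose C := c * c / K1 t.
have C0 : 0 < C by rewrite divr_gt0 // -expr2 exprn_even_gt0.
have E x : (P t 0 0).[x] * (P t 0 0).[x] * omega 0 t x = C * dens 0 t x.
  by rewrite p0E hornerC /omega /laplace_density /chebyshev_weight expr0 /C; ring.
have : mu.-integrable D1 (EFin \o (fun x => C * dens 0 t x)).
  apply: Rintegral_neq0_integrable => //.
  - apply: measurable_funM => //; apply: measurable_laplace_density => //.
    exact: measurable_chebyshev_weight.
  - by move=> x Dx; rewrite mulr_ge0 ?(ltW C0) ?density_ge0.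
  - rewrite (_ : Rintegral _ _ _ = 1) ?oner_eq0 // -[RHS](Pon 0 0)%N /ip.
    by apply: eq_Rintegral => x _; rewrite E.
move=> /(integrableZl measurable_half_line C^-1); apply: eq_integrable => //.
by move=> x _; rewrite /= -EFinM mulrA mulVf ?mul1r // gt_eqF.
Qed.

Lemma density_integrable k (t : R) : 0 < t -> mu.-integrable D1 (EFin \o dens k t).
Proof.
apply: laplace_integrable => //.
- exact: measurable_chebyshev_weight.
- exact: half_line_ge0.
- by move=> *; exact: chebyshev_weight_ge0.
- exact: density0_integrable.
Qed.

Lemma moment_derive k (t : R) : 0 < t ->
  h^-1 *: (moment (h + t) k - moment t k) @[h --> 0^'] --> - moment t k.+1.
Proof.
apply: laplace_moment_derive => //.
- exact: measurable_chebyshev_weight.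
- exact: half_line_ge0.
- by move=> *; exact: chebyshev_weight_ge0.
- exact: density0_integrable.
Qed.

(** [K1] is the first moment of [phi = cosh]; the moment of order 0 converges too, as
[cosh >= 1]. *)
Lemma K1_continuous (t : R) : 0 < t -> {for t, continuous (@K1 R)}.
Proof.
have mcosh : measurable_fun setT (@cosh R).
  apply: measurable_funM => //; apply: measurable_funD => //.
  exact: measurableT_comp.
have cosh1 (x : R) : 1 <= cosh x.
  rewrite /cosh ler_pdivlMr // mul1r.
  have := sqr_ge0 (expR x - 1); have := expR_gt0 x.
  rewrite expRN => e0 H; rewrite -subr_ge0.
  have -> : expR x + (expR x)^-1 - 2 = (expR x - 1) ^+ 2 / expR x by field; rewrite gt_eqF.
  by rewrite divr_ge0 // ltW.
have cosh0 (x : R) : 0 <= cosh x by rewrite (le_trans ler01).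
have mI : measurable (`[0, +oo[%classic : set (measurableTypeR R)) by exact: measurable_itv.
have K1E s : K1 s = laplace_moment `[0, +oo[%classic (@cosh R) (cst 1) 1 s.
  apply: eq_Rintegral => x _; by rewrite /laplace_density expr1 mulr1.
have base s : 0 < s -> mu.-integrable `[0, +oo[%classic
    (EFin \o laplace_density (@cosh R) (cst 1) 0 s).
  move=> s0.
  have H : mu.-integrable `[0, +oo[%classic (EFin \o laplace_density (@cosh R) (cst 1) 1 s).
    apply: Rintegral_neq0_integrable => //.
    - exact: measurable_laplace_density.
    - by move=> x _; rewrite !mulr_ge0 ?expR_ge0 // expr1.
    - by rewrite -/(laplace_moment _ _ _ _ _) -K1E gt_eqF ?K1_gt0.
  apply: (le_integrable mI _ _ H).
    by apply/measurable_EFinP; apply: measurable_funTS; exact: measurable_laplace_density.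
  move=> x _; rewrite /= lee_fin /laplace_density expr0 expr1 !mulr1 mul1r normrM.
  by rewrite ler_peMl // ger0_norm.
move=> t0; rewrite (_ : @K1 R = laplace_moment `[0, +oo[%classic (@cosh R) (cst 1) 1); last first.
  exact/funext/K1E.
by apply: cvg_quotient_continuous; apply: laplace_moment_derive.
Qed.

Definition poly_density (t : R) (p : {poly R}) x : R :=
  p.[x] * chebyshev_weight x * expR (- t * x).

Lemma poly_integral (t : R) p : 0 < t ->
  mu.-integrable D1 (EFin \o poly_density t p) /\
  moment_functional (moment t) p = Rintegral mu D1 (poly_density t p).
Proof.
move=> t0; pose F S x := \sum_(k < S) p`_k * dens k t x.
have pE : poly_density t p = F (size p).
  apply/funext => x; rewrite /poly_density horner_coef !mulr_suml.
  by apply: eq_bigr => k _; rewrite /laplace_density !mulrA.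
rewrite pE /moment_functional; elim: (size p) => [|S [iS IS]].
  rewrite big_ord0; have F0 : F 0%N = cst 0 by apply/funext => x; rewrite /F big_ord0.
  rewrite F0; split; first exact: integrable0.
  by rewrite /Rintegral integral0_eq.
have FS : F S.+1 = F S \+ (fun x => p`_S * dens S t x).
  by apply/funext => x; rewrite /F big_ord_recr.
have iZ : mu.-integrable D1 (EFin \o (fun x => p`_S * dens S t x)).
  exact: (integrableZl measurable_half_line p`_S (density_integrable S t0)).
rewrite FS big_ord_recr /=; split.
  exact: (integrableD measurable_half_line iS iZ).
rewrite IS RintegralD //=; congr (_ + _); rewrite RintegralZl //.
exact: density_integrable.
Qed.

Lemma moment_functional_pos (t : R) : 0 < t -> pos_functional (moment_functional (moment t)).
Proof.
move=> t0; split; [exact: moment_functionalD | exact: moment_functionalZ |].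
move=> p p0 pp; have [ip ->] := poly_integral p t0.
have w1 : chebyshev_weight 1 = 0.
  by rewrite /chebyshev_weight expr1n subrr powR0 //; apply/eqP; lra.
have d0 x : D1 x -> 0 <= poly_density t p x.
  rewrite /= in_itv /= andbT le_eqVlt => /predU1P[<-|x1].
    by rewrite /poly_density w1 mulr0 mul0r.
  by rewrite !mulr_ge0 ?expR_ge0 ?chebyshev_weight_ge0 ?pp.
rewrite lt_def Rintegral_ge0 // andbT; apply/eqP => I0.
have mdens := measurable_int _ ip.
have := ae_eq_integral_abs mu measurable_half_line mdens => -[+ _].
have -> : (\int[mu]_(x in D1) `|(EFin \o poly_density t p) x| = 0)%E.
  under eq_integral => x /set_mem Dx do rewrite /= ger0_norm ?d0 //.
  by rewrite -[LHS]fineK ?[X in X%:E]I0 // integrable_fin_num.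
move=> /(_ erefl) ae0.
(* p has no zero to the right of a, so the density is positive there *)
pose a := 1 + \sum_(r <- rootsR p) `|r| + 1.
have a1 : 1 < a by rewrite /a -addrA ltrDl ltr_wpDl // sumr_ge0.
have pa x : a < x -> p.[x] != 0.
  move=> ax; apply/negP => /eqP px.
  have xr : x \in rootsR p by rewrite in_rootsR //; apply/rootP.
  have : `|x| <= \sum_(r <- rootsR p) `|r|.
    by rewrite (big_rem x xr) /= lerDl sumr_ge0.
  have := ler_norm x; rewrite /a in ax; lra.
have neg : mu.-negligible (`]a, a + 1[%classic : set R).
  apply: negligibleS ae0 => x /=; rewrite in_itv /= => /andP[ax _] H.
  have x1 : 1 < x := lt_trans a1 ax.
  have Dx : D1 x by rewrite /= in_itv /= andbT ltW.
  have /eqP := H Dx; rewrite eqe !mulf_eq0 (negbTE (pa _ ax)) expR_eq0 orbF /=.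
  by rewrite gt_eqF // powR_gt0 // subr_gt0 exprn_egt1.
have mu0 : mu (`]a, a + 1[%classic : set R) = 0%E.
  by apply: measure_negligible; [exact: measurable_itv | exact: neg].
move: mu0; rewrite lebesgue_measure_itv /= lte_fin ltrDl ltr01 -EFinB => /eqP.
by rewrite eqe addrAC subrr add0r oner_eq0.
Qed.

Definition juttner (t : R) (p : {poly R}) : R := (K1 t)^-1 * moment_functional (moment t) p.

Lemma juttner_pos (t : R) : 0 < t -> pos_functional (juttner t).
Proof.
move=> t0; have [LD LZ Lpos] := moment_functional_pos t0; split=> [p q|c p|p p0 pp].
- by rewrite /juttner LD mulrDr.
- by rewrite /juttner LZ mulrCA.
- by rewrite mulr_gt0 ?invr_gt0 ?K1_gt0 ?Lpos.
Qed.

Lemma ip_juttner (t : R) l p q : 0 < t -> (l <= 1)%N ->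
  ip l t (horner p) (horner q) = juttner t (weight_poly l * p * q).
Proof.
move=> t0 l1; have [ip E] := poly_integral (weight_poly l * p * q) t0.
rewrite /juttner E -RintegralZl //; apply: eq_Rintegral => x.
rewrite inE /= in_itv /= andbT => x1.
rewrite /poly_density !hornerM /omega.
suff -> : (x ^+ 2 - 1) `^ (l%:R - 2^-1) = (weight_poly l).[x] * chebyshev_weight x by ring.
case: l l1 {ip E} => [|[|//]] _; rewrite /weight_poly /chebyshev_weight.
  by rewrite hornerC mul1r.
rewrite hornerD hornerN hornerXn hornerC.
have -> : 1%:R - 2^-1 = 1 + (0%:R - 2^-1) :> R by ring.
have [->|xn0] := eqVneq (x ^+ 2 - 1) 0.
  by rewrite mul0r powR0 //; apply/eqP; lra.
by rewrite powRD ?xn0 ?implybT // powRr1 // subr_ge0 exprn_ege1.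
Qed.

Lemma juttner_family (t : R) l : 0 < t -> (l <= 1)%N ->
  orthonormal_family (juttner t) (weight_poly l) (P t l).
Proof.
move=> t0 l1; have [H1 H2] := hP t0 l1; split=> // i j.
by rewrite -ip_juttner // H2.
Qed.

End JuttnerWeight.

(** * Limits of polynomials and of sorted zeros *)

Section PolyLimits.
Local Open Scope classical_set_scope.
Local Open Scope ring_scope.
Context {R : realType} {T : Type} (F : set_system T) {FF : Filter F}.
Implicit Types (f g : T -> {poly R}) (p q : {poly R}) (c x : T -> R).

(** Coefficientwise convergence with bounded degrees, which is what makes values of linear
functionals converge. *)
Definition pcvg f p : Prop :=
  (exists2 S, (size p <= S)%N & \forall t \near F, (size (f t) <= S)%N) /\
  (forall k, (f t)`_k @[t --> F] --> p`_k).

Lemma cvg_sum_ord n (h : 'I_n -> T -> R) (l : 'I_n -> R) :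
  (forall i, h i t @[t --> F] --> l i) ->
  \sum_(i < n) h i t @[t --> F] --> \sum_(i < n) l i.
Proof. by move=> H; apply: cvg_big => //; exact: add_continuous. Qed.

Lemma cvg_mulr c d (a b : R) : c t @[t --> F] --> a -> d t @[t --> F] --> b ->
  c t * d t @[t --> F] --> a * b.
Proof. exact: cvgM. Qed.

Lemma cvg_exprn c (a : R) n : c t @[t --> F] --> a -> c t ^+ n @[t --> F] --> a ^+ n.
Proof.
move=> ca; apply: (@continuous_cvg _ R R F _ c (fun u : R => u ^+ n) a) => //.
exact: exprn_continuous.
Qed.

Lemma pcvg_cst p : pcvg (fun=> p) p.
Proof. by split; [exists (size p) => //; apply: nearW | move=> k; apply: cvg_cst]. Qed.

Lemma pcvgD f g p q : pcvg f p -> pcvg g q -> pcvg (fun t => f t + g t) (p + q).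
Proof.
move=> [[S sp sf] cf] [[S' sq sg] cg]; split.
  exists (maxn S S').
    by rewrite (leq_trans (size_polyD _ _)) // geq_max !leq_max sp sq orbT.
  apply: filterS2 sf sg => t sf sg.
  by rewrite (leq_trans (size_polyD _ _)) // geq_max !leq_max sf sg orbT.
move=> k; rewrite coefD; under eq_cvg do rewrite coefD.
exact: cvgD (cf k) (cg k).
Qed.

Lemma pcvgM f g p q : pcvg f p -> pcvg g q -> pcvg (fun t => f t * g t) (p * q).
Proof.
move=> [[S sp sf] cf] [[S' sq sg] cg]; split.
  exists (S + S')%N.
    by rewrite (leq_trans (size_polyMleq _ _)) // (leq_trans (leq_pred _)) // leq_add.
  apply: filterS2 sf sg => t sf sg.
  by rewrite (leq_trans (size_polyMleq _ _)) // (leq_trans (leq_pred _)) // leq_add.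
move=> k; rewrite coefM; under eq_cvg do rewrite coefM.
by apply: cvg_sum_ord => i; apply: cvg_mulr.
Qed.

Lemma pcvgC c (a : R) : c t @[t --> F] --> a -> pcvg (fun t => (c t)%:P) a%:P.
Proof.
move=> ca; split.
  by exists 1%N; [exact: size_polyC_leq1 | apply: nearW => t; exact: size_polyC_leq1].
move=> k; rewrite coefC; under eq_cvg do rewrite coefC.
by case: (k == 0)%N => //; exact: cvg_cst.
Qed.

Lemma pcvgZ c (a : R) f p : c t @[t --> F] --> a -> pcvg f p ->
  pcvg (fun t => c t *: f t) (a *: p).
Proof.
move=> ca fp; rewrite -mul_polyC.
rewrite (_ : (fun t => c t *: f t) = fun t => (c t)%:P * f t).
  by apply: pcvgM => //; exact: pcvgC.
by apply/funext => t; rewrite mul_polyC.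
Qed.

Lemma pcvgN f p : pcvg f p -> pcvg (fun t => - f t) (- p).
Proof.
move=> fp; rewrite -scaleN1r (_ : (fun t => - f t) = fun t => (-1) *: f t).
  by apply: pcvgZ => //; exact: cvg_cst.
by apply/funext => t; rewrite scaleN1r.
Qed.

Lemma pcvgB f g p q : pcvg f p -> pcvg g q -> pcvg (fun t => f t - g t) (p - q).
Proof. by move=> fp gq; apply: pcvgD => //; exact: pcvgN. Qed.

Lemma pcvg_sum n (h : nat -> T -> {poly R}) (l : nat -> {poly R}) :
  (forall i, (i < n)%N -> pcvg (h i) (l i)) ->
  pcvg (fun t => \sum_(i < n) h i t) (\sum_(i < n) l i).
Proof.
elim: n => [|n IH] H.
  rewrite big_ord0 (_ : (fun t => _) = fun=> 0); first exact: pcvg_cst.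
  by apply/funext => t; rewrite big_ord0.
rewrite big_ord_recr (_ : (fun t => _) = fun t => \sum_(i < n) h i t + h n t).
  apply: pcvgD; last exact: H.
  by apply: IH => i ni; apply: H; apply: ltnW.
by apply/funext => t; rewrite big_ord_recr.
Qed.

Lemma pcvg_compN f p : pcvg f p -> pcvg (fun t => f t \Po - 'X) (p \Po - 'X).
Proof.
move=> [[S sp sf] cf].
have sN q : size (q \Po - 'X) = size q.
  by rewrite size_comp_poly2 // size_polyN size_polyX.
split; first by exists S; [rewrite sN | apply: filterS sf => t; rewrite sN].
move=> k; rewrite coef_compN; under eq_cvg do rewrite coef_compN.
by apply: cvg_mulr => //; exact: cvg_cst.
Qed.

Lemma pcvg_linear (m : nat -> T -> R) (l : nat -> R) f p : pcvg f p ->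
  (forall k, m k t @[t --> F] --> l k) ->
  \sum_(k < size (f t)) (f t)`_k * m k t @[t --> F] --> \sum_(k < size p) p`_k * l k.
Proof.
move=> [[S sp sf] cf] ml.
have -> : \sum_(k < size p) p`_k * l k = \sum_(k < S) p`_k * l k.
  exact: moment_functional_wide.
apply: cvg_trans (_ : \sum_(k < S) (f t)`_k * m k t @[t --> F] --> _).
  apply: near_eq_cvg; apply: filterS sf => t sf.
  exact: esym (moment_functional_wide (fun k => m k t) sf).
by apply: cvg_sum_ord => k; apply: cvg_mulr.
Qed.

Lemma pcvg_horner f p x (a : R) : pcvg f p -> x t @[t --> F] --> a ->
  (f t).[x t] @[t --> F] --> p.[a].
Proof.
move=> fp xa; rewrite horner_coef; under eq_cvg do rewrite horner_coef.
by apply: (pcvg_linear (m := fun k t => x t ^+ k)) => // k; exact: cvg_exprn.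
Qed.

Lemma pcvg_kernel (Q : T -> nat -> {poly R}) (q : nat -> {poly R}) m x (a : R) :
  (forall k, (k < m)%N -> pcvg (Q ^~ k) (q k)) -> x t @[t --> F] --> a ->
  pcvg (fun t => kernel (Q t) m (x t)) (kernel q m a).
Proof.
move=> H xa; apply: (pcvg_sum (h := fun k t => (Q t k).[x t] *: Q t k)
  (l := fun k => (q k).[a] *: q k)) => k km.
by apply: pcvgZ (H k km); apply: pcvg_horner (H k km) xa.
Qed.

End PolyLimits.

Section SortedRoots.
Local Open Scope classical_set_scope.
Local Open Scope ring_scope.
Context {R : realType}.

(** A single radius works for all the zeros: each condition holds for all small [d]. *)
Lemma zeros_isolated (s : seq R) e : 0 < e -> sorted <%R s -> (forall x, x \in s -> 1 < x) ->
  exists d, [/\ 0 < d, d < e, forall i, (i < size s)%N -> 1 < nth 0 s i - d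
    & forall i j, (i < j)%N -> (j < size s)%N -> nth 0 s i + d < nth 0 s j - d].
Proof.
move=> e0 ss s1.
have H : \forall d \near 0^'+, [/\ 0 < d, d < e,
    forall i : 'I_(size s), 1 < nth 0 s i - d
    & forall i j : 'I_(size s), (i < j)%N -> nth 0 s i + d < nth 0 s j - d].
  near=> d; split.
  - by near: d; exact: nbhs_right_gt.
  - by near: d; exact: nbhs_right_lt.
  - near: d; apply: filter_forall => i.
    have : 0 < nth 0 s i - 1 by rewrite subr_gt0 s1 // mem_nth.
    by move=> /nbhs_right_lt; apply: filterS => d; rewrite !ltrBrDr addrC.
  - near: d; apply: filter_forall => i; apply: filter_forall => j.
    have [ij|ji] := ltnP i j; last by apply: nearW.
    have : 0 < (nth 0 s j - nth 0 s i) / 2.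
      rewrite divr_gt0 // subr_gt0 (lt_sorted_ltn_nth 0 ss) ?inE //.
    move=> /nbhs_right_lt; apply: filterS => d dlt _; lra.
have [d [d0 de d1 d2]] := filter_ex H.
exists d; split=> // [i si|i j ij sj]; first exact: (d1 (Ordinal si)).
exact: (d2 (Ordinal (ltn_trans ij sj)) (Ordinal sj)).
Unshelve. all: by end_near.
Qed.

(** A sorted sequence with as many entries as there are separated intervals, each met by
the sequence, is the sequence of those meeting points in order. *)
Lemma nth_sorted_localised (s : seq R) (a b : nat -> R) (r : nat -> R) n :
  size s = n -> sorted <%R s ->
  (forall i, (i < n)%N -> r i \in s /\ a i < r i < b i) ->
  (forall i j, (i < j)%N -> (j < n)%N -> b i < a j) ->
  forall i, (i < n)%N -> nth 0 s i = r i.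
Proof.
move=> sn ss rP sep i ni.
have rlt j k : (j < k)%N -> (k < n)%N -> r j < r k.
  move=> jk nk; have [_ /andP[_ h1]] := rP j (ltn_trans jk nk).
  have [_ /andP[h2 _]] := rP k nk.
  exact: lt_trans h1 (lt_trans (sep j k jk nk) h2).
pose s' := mkseq r n.
have ss' : sorted <%R s'.
  apply/(sortedP 0) => k; rewrite size_mkseq => kn.
  by rewrite !nth_mkseq ?rlt // ltnW.
have us' : uniq s' by apply: lt_sorted_uniq.
have sub : {subset s' <= s}.
  by move=> x /mapP[k]; rewrite mem_iota add0n => /andP[_ kn] ->; have [] := rP k kn.
have [|_ eqs] := uniq_min_size us' sub; first by rewrite size_mkseq sn.
by rewrite (lt_sorted_eq ss ss' (fun x => esym (eqs x))) nth_mkseq.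
Qed.

End SortedRoots.

(** * Dependence on the parameter *)

Section Dynamics.
Local Open Scope classical_set_scope.
Local Open Scope ring_scope.
Context {R : realType} (P : R -> nat -> nat -> {poly R}).
Hypothesis hP : forall (zeta : R) (l : nat), 0 < zeta -> (l <= 1)%N ->
          orthonormal_polys l zeta (P zeta l).
Variable zeta : R.
Hypothesis zeta0 : 0 < zeta.

Let near_pos : \forall t \near zeta, 0 < t.
Proof. exact: (@cvgr_gt _ _ (nbhs zeta) _ id zeta (@cvg_id _ _) 0 zeta0). Qed.

Lemma moment_cvg k : moment t k @[t --> zeta] --> moment zeta k.
Proof. by have /cvg_quotient_continuous := moment_derive (k := k) hP zeta0. Qed.

Lemma juttner_cvg f p : pcvg (nbhs zeta) f p ->
  juttner t (f t) @[t --> zeta] --> juttner zeta p.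
Proof.
move=> fp; apply: cvg_mulr; last first.
  by apply: (pcvg_linear (m := fun k t => moment t k)) => // k; exact: moment_cvg.
apply: cvgV; first by rewrite gt_eqF // (K1_gt0 hP).
exact: (K1_continuous hP).
Qed.

Lemma pos_weight_poly l : pos_weight (weight_poly l : {poly R}).
Proof. by case: l => [|l]; [exact: pos_weight1 | exact: pos_weight_X2]. Qed.

(** By induction on the degree, through the Gram-Schmidt formula. *)
Lemma orthonormal_cvg l k : (l <= 1)%N ->
  pcvg (nbhs zeta) (fun t => P t l k) (P zeta l k).
Proof.
move=> l1; elim/ltn_ind: k => k IH.
pose r t := 'X^k - \sum_(j < k) juttner t (weight_poly l * P t l j * 'X^k) *: P t l j.
pose N t := juttner t (weight_poly l * r t * r t).
have gs t : 0 < t -> 0 < N t /\ P t l k = (Num.sqrt (N t))^-1 *: r t.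
  move=> t0.
  exact: (gram_schmidt (juttner_pos hP t0) (juttner_family hP t0 l1) (@pos_weight_poly l)).
have rc : pcvg (nbhs zeta) r (r zeta).
  apply: pcvgB; first exact: pcvg_cst.
  apply: (pcvg_sum (h := fun j t => juttner t (weight_poly l * P t l j * 'X^k) *: P t l j)
    (l := fun j => juttner zeta (weight_poly l * P zeta l j * 'X^k) *: P zeta l j)) => j jk.
  apply: pcvgZ (IH j jk); apply: juttner_cvg.
  by apply: pcvgM; [apply: pcvgM; [exact: pcvg_cst | exact: IH] | exact: pcvg_cst].
have Nc : N t @[t --> zeta] --> N zeta.
  by apply: juttner_cvg; do 2 (apply: pcvgM => //); exact: pcvg_cst.
have [N0 ->] := gs _ zeta0.
have E : \forall t \near zeta, (Num.sqrt (N t))^-1 *: r t = P t l k.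
  by apply: filterS near_pos => t t0; have [_ ->] := gs _ t0.
have : pcvg (nbhs zeta) (fun t => (Num.sqrt (N t))^-1 *: r t)
    ((Num.sqrt (N zeta))^-1 *: r zeta).
  apply: pcvgZ rc; apply: cvgV; first by rewrite gt_eqF // sqrtr_gt0.
  by apply: (@continuous_cvg _ R R _ _ N Num.sqrt (N zeta)) => //; exact: sqrt_continuous.
move=> [[S sp sf] cf]; split.
  by exists S => //; apply: filterS2 sf E => t sf <-.
move=> j; apply: cvg_trans (cf j); apply: near_eq_cvg.
by apply: filterS E => t ->.
Qed.

Variable n : nat.
Hypothesis n_gt0 : (0 < n)%N.

Let on0 t (t0 : 0 < t) : orthonormal_family (juttner t) 1 (P t 0).
Proof. exact: (juttner_family hP t0 (leq0n 1)). Qed.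

Let on1 t (t0 : 0 < t) : orthonormal_family (juttner t) ('X^2 - 1) (P t 1).
Proof. exact: (juttner_family hP t0 (leqnn 1)). Qed.

Let Q t := Qpoly (P t) n.

Let on0S t (t0 : 0 < t) := family_orthonormal_at (juttner_pos hP t0) (on0 t0) n.+1.
Let on1n t (t0 : 0 < t) := family_orthonormal_at (juttner_pos hP t0) (on1 t0) n.

Lemma Qpoly_cvg : pcvg (nbhs zeta) Q (Q zeta).
Proof.
apply: pcvgD; apply: pcvgM; try apply: pcvg_compN; exact: orthonormal_cvg.
Qed.

(** Small intervals around the zeros of [Q zeta] have sign changes at their ends, which
persist for [t] near [zeta].  Each then contains a zero of [Q t], and as [Q t] has
exactly [n] zeros beyond 1 the order is preserved. *)
Lemma nth_zeros_cvg j : (j < n)%N ->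
  nth 0 (zeros_gt1 (Q t)) j @[t --> zeta] --> nth 0 (zeros_gt1 (Q zeta)) j.
Proof.
move=> jn; apply/cvgrPdist_lt => e e0.
have sz t (t0 : 0 < t) : size (zeros_gt1 (Q t)) = n.
  exact: (size_zeros_gt1 (juttner_pos hP t0) (on0S t0) (on1n t0)).
have Qn0 t (t0 : 0 < t) : Q t != 0.
  exact: (Qpair_neq0 (juttner_pos hP t0) (on0S t0) (on1n t0)).
set Z := zeros_gt1 (Q zeta).
have sZ : size Z = n by apply: sz.
have Z1 x : x \in Z -> 1 < x by rewrite mem_zeros_gt1 ?Qn0 // => /andP[].
have ssZ : sorted <%R Z by apply: zeros_gt1_sorted.
have [d [d0 de d1 d2]] := zeros_isolated e0 ssZ Z1.
rewrite sZ in d1 d2.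
have sgn (i : 'I_n) : \forall t \near zeta, (Q t).[nth 0 Z i - d] * (Q t).[nth 0 Z i + d] < 0.
  have ni := ltn_ord i.
  have neg : (Q zeta).[nth 0 Z i - d] * (Q zeta).[nth 0 Z i + d] < 0.
    apply: (Qpair_sign_change (juttner_pos hP zeta0) (on0S zeta0) (on1n zeta0)
      (z := nth 0 Z i)).
    - by rewrite mem_nth // sZ.
    - exact: d1.
    - by apply/andP; split; lra.
    - move=> x /(nthP 0)[k]; rewrite -/(Qpoly _ _) -/(Q zeta) -/Z sZ => kn <- /andP[h1 h2].
      case: (ltngtP k i) => [ki|ik|->//].
        by have := d2 k i ki ni; lra.
      by have := d2 i k ik kn; lra.
  have cv : (Q t).[nth 0 Z i - d] * (Q t).[nth 0 Z i + d] @[t --> zeta] -->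
      (Q zeta).[nth 0 Z i - d] * (Q zeta).[nth 0 Z i + d].
    by apply: cvg_mulr; apply: pcvg_horner Qpoly_cvg _; exact: cvg_cst.
  exact: (cvgr_lt _ cv _ neg).
have sgn' : \forall t \near zeta, forall i : 'I_n,
    (Q t).[nth 0 Z i - d] * (Q t).[nth 0 Z i + d] < 0 by exact: (filter_forall _ sgn).
apply: filterS2 near_pos sgn' => t t0 H.
have /choice[r rP] : forall k, exists c, (k < n)%N ->
    c \in zeros_gt1 (Q t) /\ nth 0 Z k - d < c < nth 0 Z k + d.
  move=> k; case: (ltnP k n) => [kn|_]; last by exists 0.
  have [|c] := poly_ivtoo _ (H (Ordinal kn)); first by rewrite /=; lra.
  rewrite in_itv /= => /andP[c1 c2] rc; exists c => _.
  rewrite mem_zeros_gt1 ?Qn0 // rc (lt_trans (d1 k kn) c1) c1 c2 //.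
have -> := nth_sorted_localised (sz t t0) (zeros_gt1_sorted _) rP d2 jn.
have [_ /andP[c1 c2]] := rP j jn.
by rewrite ltr_norml; apply/andP; split; lra.
Qed.

Lemma zQ_cvg i : (`|i| <= n)%N -> zQ (P t) n i @[t --> zeta] --> zQ (P zeta) n i.
Proof.
move=> ni; have [->|i0] := eqVneq i 0.
  by rewrite zQ0; under eq_cvg do rewrite zQ0; exact: cvg_cst.
rewrite zQE; under eq_cvg do rewrite zQE.
apply: cvg_mulr; first exact: cvg_cst.
by apply: nth_zeros_cvg; move: i0 ni; case: i => [[|k]|k].
Qed.

Lemma lamQ_cvg i : i != 0 -> (`|i| <= n)%N -> lamQ (P t) n i @[t --> zeta] --> lamQ (P zeta) n i.
Proof.
move=> i0 ni; have zc := zQ_cvg ni.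
have [z1 _ _] := zQ_root (juttner_pos hP zeta0) (fun l => juttner_family hP zeta0 (l := l)) i0 ni.
apply: cvg_mulr; last first.
  apply: cvgV => //; apply: contraTneq z1 => ->.
  by rewrite expr0n /= ltr10.
apply: (@continuous_cvg _ R R _ _ _ Num.sqrt); first exact: sqrt_continuous.
by apply: cvgB; [exact: cvg_exprn | exact: cvg_cst].
Qed.

Lemma eigen_f_cvg z (a : R) : z t @[t --> zeta] --> a ->
  pcvg (nbhs zeta) (fun t => eigen_f (P t 0) (P t 1) n (z t)) (eigen_f (P zeta 0) (P zeta 1) n a).
Proof.
move=> za; have zna : - z t @[t --> zeta] --> - a by exact: cvgN.
apply: pcvgD; apply: pcvgZ.
- by apply: pcvg_horner zna; exact: orthonormal_cvg.
- by apply: (pcvg_kernel (Q := fun t => P t 0)) => // k _; exact: orthonormal_cvg.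
- by apply: pcvg_horner za; exact: orthonormal_cvg.
- by apply: (pcvg_kernel (Q := fun t => P t 0)) => // k _; exact: orthonormal_cvg.
Qed.

Lemma eigen_g_cvg z (a : R) : z t @[t --> zeta] --> a ->
  pcvg (nbhs zeta) (fun t => eigen_g (P t 1) n (z t)) (eigen_g (P zeta 1) n a).
Proof.
move=> za; have zna : - z t @[t --> zeta] --> - a by exact: cvgN.
apply: pcvgZ.
  apply: (@continuous_cvg _ R R _ _ _ Num.sqrt); first exact: sqrt_continuous.
  by apply: cvgB; [exact: cvg_exprn | exact: cvg_cst].
apply: pcvgB; apply: pcvgZ.
- by apply: pcvg_horner zna; exact: orthonormal_cvg.
- by apply: (pcvg_kernel (Q := fun t => P t 1)) => // k _; exact: orthonormal_cvg.
- by apply: pcvg_horner za; exact: orthonormal_cvg.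
- by apply: (pcvg_kernel (Q := fun t => P t 1)) => // k _; exact: orthonormal_cvg.
Qed.

Let shift_cvg : (u + zeta) @[u --> 0^'] --> zeta.
Proof.
have sh : (u + zeta) @[u --> (0 : R)] --> zeta.
  by rewrite -[X in _ --> X]add0r; apply: cvgD; [exact: cvg_id | exact: cvg_cst].
by apply: cvg_trans sh; apply: cvg_app; exact: cvg_within.
Qed.

Let cvg_shift (h : R -> R) (l : R) : h t @[t --> zeta] --> l -> h (u + zeta) @[u --> 0^'] --> l.
Proof. by move=> hl; apply: cvg_comp shift_cvg hl. Qed.

Let near_shift (A : R -> Prop) : (\forall t \near zeta, A t) -> \forall u \near 0^', A (u + zeta).
Proof. by move=> nA; apply: (shift_cvg nA). Qed.

Let pcvg_shift (f : R -> {poly R}) (p : {poly R}) : 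
  pcvg (nbhs zeta) f p -> pcvg 0^' (fun u => f (u + zeta)) p.
Proof.
move=> [[S sp sf] cf]; split; last by move=> k; apply: (cvg_shift (cf k)).
by exists S => //; apply: near_shift sf.
Qed.

Let L := moment_functional (moment zeta).
Let N0 f g phi psi : {poly R} := 'X * (f * phi + ('X^2 - 1) * (g * psi)).
Let N1 f g phi psi : {poly R} := ('X^2 - 1) * (g * phi + f * psi).

Lemma eigen_pair_scale (c : R) (M M' : {poly R} -> R) lam f g :
  (forall p, M' p = c * M p) -> eigen_pair M n lam f g -> eigen_pair M' n lam f g.
Proof.
move=> E [h1 h2]; split=> [phi sphi|psi spsi]; rewrite !E.
  by rewrite h1 // mulrCA.
by rewrite h2 // mulrCA.
Qed.

Lemma moment_eigen_pair t i : 0 < t -> i != 0 -> (`|i| <= n)%N ->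
  eigen_pair (moment_functional (moment t)) n (lamQ (P t) n i)
    (eigen_f (P t 0) (P t 1) n (zQ (P t) n i)) (eigen_g (P t 1) n (zQ (P t) n i)).
Proof.
move=> t0 i0 ni.
have [z1 rz _] := zQ_root (juttner_pos hP t0) (fun l => juttner_family hP t0 (l := l)) i0 ni.
apply: (@eigen_pair_scale (K1 t) (juttner t)).
  by move=> p; rewrite /juttner mulVKf // gt_eqF // (K1_gt0 hP).
apply: (eigen_pair_kernel (juttner_pos hP t0) (on0 t0) (on1 t0)) => //.
Qed.

(** The relation at [t] tested on the eigenvector at [zeta] and the relation at [zeta]
tested on the eigenvector at [t] have the same bilinear forms but different
moments ([key]).  Dividing their difference by [t - zeta] only uses that the
eigenvectors are continuous, and the derivative of a moment is minus the next
one, whence the factor [X] in the limit. *)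
Lemma lamQ_quotient i : 0 < i -> (`|i| <= n)%N ->
  exists2 d : R, d < 0 & h^-1 *: (lamQ (P (h + zeta)) n i - lamQ (P zeta) n i) @[h --> 0^'] --> d.
Proof.
move=> ip ni; have i0 : i != 0 by rewrite gt_eqF.
pose la t := lamQ (P t) n i.
pose f t := eigen_f (P t 0) (P t 1) n (zQ (P t) n i).
pose g t := eigen_g (P t 1) n (zQ (P t) n i).
have eig t : 0 < t -> eigen_pair (moment_functional (moment t)) n (la t) (f t) (g t).
  by move=> t0; apply: moment_eigen_pair.
have sf t : 0 < t -> (size (f t) <= n.+1)%N.
  by move=> t0; apply: (size_eigen_f _ _ (on0 t0)).
have sg t : 0 < t -> (size (g t) <= n)%N.
  by move=> t0; apply: (size_eigen_g _ (on1 t0)).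
have posL := moment_functional_pos hP zeta0.
have LD : forall p q, L (p + q) = L p + L q := functionalD posL.
have LZ : forall c p, L (c *: p) = c * L p := functionalZ posL.
have LB : forall p q, L (p - q) = L p - L q := functionalB posL.
have fc : pcvg (nbhs zeta) f (f zeta) by apply: eigen_f_cvg; apply: zQ_cvg.
have gc : pcvg (nbhs zeta) g (g zeta) by apply: eigen_g_cvg; apply: zQ_cvg.
have lc : la t @[t --> zeta] --> la zeta by apply: lamQ_cvg.
pose den t := L (N0 (f t) (g t) (f zeta) (g zeta)).
pose r t := N1 (f t) (g t) (f zeta) (g zeta) - la t *: N0 (f t) (g t) (f zeta) (g zeta).
have N0c : pcvg (nbhs zeta) (fun t => N0 (f t) (g t) (f zeta) (g zeta))
   (N0 (f zeta) (g zeta) (f zeta) (g zeta)).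
  apply: pcvgM; first exact: pcvg_cst.
  by apply: pcvgD; do ?[apply: pcvgM | exact: pcvg_cst].
have rc : pcvg (nbhs zeta) r (r zeta).
  apply: pcvgB; last exact: pcvgZ.
  apply: pcvgM; first exact: pcvg_cst.
  by apply: pcvgD; do ?[apply: pcvgM | exact: pcvg_cst].
have denc : den t @[t --> zeta] --> den zeta.
  by apply: (pcvg_linear (m := fun k _ => moment zeta k)) N0c _ => k; exact: cvg_cst.
have key t : 0 < t -> (la t - la zeta) * den t =
    \sum_(k < size (r t)) (r t)`_k * (moment t k - moment zeta k).
  move=> t0; have [a1 a2] := eig t t0; have [b1 b2] := eig _ zeta0.
  have E1 : moment_functional (moment t) (r t) = 0.
    have -> : r t = ('X^2 - 1) * g t * f zeta + ('X^2 - 1) * f t * g zeta -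
        la t *: ('X * f t * f zeta + 'X * ('X^2 - 1) * g t * g zeta).
      by rewrite /r /N0 /N1 -!mul_polyC; ring.
    rewrite !moment_functionalD a1 ?sf // a2 ?sg // -scaleNr moment_functionalZ.
    by rewrite moment_functionalD; ring.
  have E2 : L (N1 (f t) (g t) (f zeta) (g zeta)) = la zeta * den t.
    have -> : N1 (f t) (g t) (f zeta) (g zeta) =
      ('X^2 - 1) * g zeta * f t + ('X^2 - 1) * f zeta * g t by rewrite /N1; ring.
    rewrite LD [L (_ * f t)]b1 ?sf // [L (_ * g t)]b2 ?sg // -mulrDr -LD; congr (_ * L _).
    by rewrite /N0; ring.
  have E3 : L (r t) = (la zeta - la t) * den t by rewrite LB LZ E2 -mulrBl.
  transitivity (moment_functional (moment t) (r t) - L (r t)).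
    by rewrite E1 E3; ring.
  rewrite /L /moment_functional -sumrB; apply: eq_bigr => k _; by rewrite mulrBr.
have fg0 : (f zeta != 0) || (g zeta != 0).
  have := yvec_neq0 (juttner_pos hP zeta0) (fun l => juttner_family hP zeta0 (l := l)) n_gt0 ni.
  apply: contraNT; rewrite negb_or !negbK => /andP[/eqP f0 /eqP g0].
  have jf := fun l => juttner_family hP zeta0 (l := l).
  have u0 : uvec (P zeta) n i = 0.
    apply: (poly_of_eq0 (juttner_pos hP zeta0) jf (l := 0)) => //.
    by rewrite poly_of_uvec.
  have v0 : vvec (P zeta) n i = 0.
    apply: (poly_of_eq0 (juttner_pos hP zeta0) jf (l := 1)) => //.
    by rewrite poly_of_vvec.
  by rewrite /yvec u0 v0 col_mx0.
have den0 : 0 < den zeta by apply: (eigen_pair_norm_gt0 posL).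
have num0 : 0 < L ('X * r zeta).
  have [z1 _] := zQ_root_gt1 (juttner_pos hP zeta0) (fun l => juttner_family hP zeta0 (l := l)) ip ni.
  have eigJ : eigen_pair (juttner zeta) n (la zeta) (f zeta) (g zeta).
    by apply: eigen_pair_scale (eig _ zeta0).
  have sE : Num.sqrt (zQ (P zeta) n i ^+ 2 - 1) ^+ 2 = zQ (P zeta) n i ^+ 2 - 1.
    by rewrite sqr_sqrtr // subr_ge0 exprn_ege1 // ltW.
  have := eigen_pair_markov (juttner_pos hP zeta0) (on0S zeta0) (on1n zeta0)
    z1 (sqrtr_ge0 _) sE (sf _ zeta0) (sg _ zeta0) eigJ fg0.
  rewrite /juttner pmulr_rgt0 ?invr_gt0 ?(K1_gt0 hP) // -/L -[Num.sqrt _ / _]/(la zeta).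
  congr (0 < L _); rewrite /r /N1 /N0 -!mul_polyC; ring.
exists (- L ('X * r zeta) / den zeta); first by rewrite pmulr_llt0 ?invr_gt0 // oppr_lt0.
have lim : (\sum_(k < size (r (h + zeta))) (r (h + zeta))`_k *
     (h^-1 * (moment (h + zeta) k - moment zeta k))) / den (h + zeta) @[h --> 0^'] -->
   - L ('X * r zeta) / den zeta.
  apply: cvg_mulr; last by apply: cvgV; [rewrite gt_eqF | exact: cvg_shift].
  have -> : - L ('X * r zeta) = \sum_(k < size (r zeta)) (r zeta)`_k * - moment zeta k.+1.
    rewrite /L moment_functionalX /moment_functional -sumrN.
    by apply: eq_bigr => k _; rewrite mulrN.
  exact: (pcvg_linear (m := fun k h => h^-1 * (moment (h + zeta) k - moment zeta k))
    (l := fun k => - moment zeta k.+1) (pcvg_shift rc)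
    (fun k => moment_derive (k := k) hP zeta0)).
apply: cvg_trans lim; apply: near_eq_cvg.
have dpos : \forall u \near 0^', 0 < den (u + zeta).
  exact: (near_shift (cvgr_gt _ denc _ den0)).
have upos := near_shift near_pos.
apply: filterS2 upos dpos => u u0 du.
have /(canRL (mulfK (lt0r_neq0 du))) E := key _ u0.
rewrite -/(la _) -/(la zeta) E /GRing.scale /= mulrA; congr (_ / _).
by rewrite mulr_sumr; apply: eq_bigr => k _; rewrite mulrCA.
Qed.

Lemma lamQ_derive i : i != 0 -> (`|i| <= n)%N ->
  derivable (fun t : R => lamQ (P t) n i) zeta 1 /\
  (if 0 < i then (fun t : R => lamQ (P t) n i)^`()%classic zeta < 0
   else 0 < (fun t : R => lamQ (P t) n i)^`()%classic zeta).
Proof.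
move=> i0 ni; case: ifPn => [ip|].
  have [d d0 dl] := lamQ_quotient ip ni.
  by have [? ->] := @cvg_quotient_derivable _ (fun t => lamQ (P t) n i) _ _ dl.
rewrite -leNgt le_eqVlt (negbTE i0) /= => in0.
have [|//|d d0 dl] := @lamQ_quotient (- i); rewrite ?oppr_gt0 ?abszN //.
have {}dl := cvgN dl.
have E : - (fun h : R => h^-1 *: (lamQ (P (h + zeta)) n (- i) - lamQ (P zeta) n (- i))) =
    (fun h : R => h^-1 *: (lamQ (P (h + zeta)) n i - lamQ (P zeta) n i)).
  by apply/funext => h; rewrite fctE !lamQ_oppr -scalerN opprB opprK addrC.
rewrite E in dl.
by have [? ->] := @cvg_quotient_derivable _ (fun t => lamQ (P t) n i) _ _ (dl _); rewrite oppr_gt0.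
Qed.

End Dynamics.

(** * The theorem *)

Theorem theorem3p7 (R : realType) (P : R -> nat -> nat -> {poly R})
  (hP : forall (zeta : R) (l : nat), 0 < zeta -> (l <= 1)%N ->
          orthonormal_polys l zeta (P zeta l))
  (n : nat) (hn : (1 <= n)%N) :
  exists lam : R -> int -> R,
    forall zeta : R, 0 < zeta ->
      let M0 := A0 zeta (P zeta) n in
      let M1 := A1 (P zeta) n in
      let z := zQ (P zeta) n in
      let y := yvec (P zeta) n in
      [/\ (* the eigenvalues of the pair among the complex numbers *)
          lam zeta 0 = 0 /\
          (forall mu : R[i],
             gen_eigenvalue (complex_mx M1) (complex_mx M0) mu <->
             exists2 i : int, (`|i| <= n)%N & mu = ((lam zeta i)%:C)%C),
          (forall i j : int, (`|i| <= n)%N -> (`|j| <= n)%N ->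
             lam zeta i = lam zeta j -> i = j),
          (forall i : int, i != 0 -> (`|i| <= n)%N ->
             [/\ lam zeta i != 0,
                 simple_gen_eigenvalue (complex_mx M1) (complex_mx M0)
                   ((lam zeta i)%:C)%C,
                 lam zeta i = Num.sqrt (z i ^+ 2 - 1) / z i
               & `|lam zeta i| < 1]),
          (forall i : int, i != 0 -> (`|i| <= n)%N ->
             derivable (fun t : R => lam t i) zeta 1 /\
             (if 0 < i then (fun t : R => lam t i)^`()%classic zeta < 0
              else 0 < (fun t : R => lam t i)^`()%classic zeta))
        & (* the eigenvectors are exactly the nonzero multiples of y i *)
          (forall i : int, (`|i| <= n)%N ->
             y i != 0 /\
             (forall w : 'cV[R[i]]_(n.+1 + n),
                complex_mx M1 *m w = ((lam zeta i)%:C)%C *: (complex_mx M0 *m w)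
                <-> exists c : R[i], w = c *: complex_mx (y i)))].
Proof.
exists (fun t i => lamQ (P t) n i) => zeta zeta0 M0 M1 z y.
have posL := juttner_pos hP zeta0.
have onL := fun l => juttner_family hP zeta0 (l := l).
have ipL := fun l p q => ip_juttner hP (l := l) p q zeta0.
have [ev simple evec] := spectral_facts posL ipL onL hn.
split.
- by split; [exact: lamQ0 | exact: ev].
- by move=> i j; apply: (lamQ_inj posL onL).
- move=> i i0 ni; split; [exact: (lamQ_neq0 posL onL) | exact: simple | by [] |].
  exact: (lamQ_norm_lt1 posL onL).
- by move=> i i0 ni; apply: lamQ_derive.
- by move=> i ni; split; [exact: (yvec_neq0 posL onL) | exact: evec].
Qed.
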